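(* The group $G_2=\{\alpha\in \mathrm{Iso}_{\mathbb R}(\mathfrak C)\mid \alpha(xy)=(\alpha x)(\alpha y)\ \text{for all } x,y\in\mathfrak C\}$ of automorphisms of the division Cayley algebra $\mathfrak C$ is a simply connected compact simple Lie group.
   Context: $\mathbb H$ is the field of quaternions with basis $1,e_1,e_2,e_3$ ($e_1e_2=e_3$, etc.). The (division) Cayley algebra is $\mathfrak C=\mathbb H\oplus\mathbb He_4$ with multiplication $(m+ae_4)(n+be_4)=(mn-\overline b a)+(a\overline n+bm)e_4$, $m,a,n,b\in\mathbb H$. $\mathrm{Iso}_{\mathbb R}(V)$ denotes the group of $\mathbb R$-linear isomorphisms of $V$; $G_2$ has the topology and Lie group structure of a closed subgroup of $GL(8,\mathbb R)$. *)

(* Defs.v *)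
From HB Require Import structures.
From mathcomp Require Import all_boot all_order all_algebra.
From mathcomp Require Import all_classical all_reals all_analysis.

Set Implicit Arguments.
Unset Strict Implicit.
Unset Printing Implicit Defensive.

Import Order.TTheory GRing.Theory Num.Theory.
Import numFieldNormedType.Exports.

Local Open Scope classical_set_scope.
Local Open Scope ring_scope.

(* Coordinates with respect to the basis 1, e_1, e_2, e_3. *)
Definition quaternion (R : realType) := 'cV[R]_4.

Definition quat (R : realType) (a b c d : R) : quaternion R :=
  \col_(i < 4) [:: a; b; c; d]`_i.

Definition qcoord (R : realType) (x : quaternion R) (k : nat) : R :=
  x (inord k) ord0.

(* Hamilton product: e_i^2 = -1, e_1 e_2 = e_3 = - e_2 e_1, and cyclically. *)
Definition qmul (R : realType) (x y : quaternion R) : quaternion R :=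
  let: (x0, x1, x2, x3) := (qcoord x 0, qcoord x 1, qcoord x 2, qcoord x 3) in
  let: (y0, y1, y2, y3) := (qcoord y 0, qcoord y 1, qcoord y 2, qcoord y 3) in
  quat (x0 * y0 - x1 * y1 - x2 * y2 - x3 * y3)
       (x0 * y1 + x1 * y0 + x2 * y3 - x3 * y2)
       (x0 * y2 - x1 * y3 + x2 * y0 + x3 * y1)
       (x0 * y3 + x1 * y2 - x2 * y1 + x3 * y0).

Definition qconj (R : realType) (x : quaternion R) : quaternion R :=
  quat (qcoord x 0) (- qcoord x 1) (- qcoord x 2) (- qcoord x 3).

(* m + a e_4 is the column obtained by stacking m on top of a. *)
Definition cayley (R : realType) := 'cV[R]_(4 + 4).

(* (m + a e_4)(n + b e_4) = (m n - b^* a) + (a n^* + b m) e_4 *)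
Definition cmul (R : realType) (x y : cayley R) : cayley R :=
  let m := usubmx x in let a := dsubmx x in
  let n := usubmx y in let b := dsubmx y in
  col_mx (qmul m n - qmul (qconj b) a) (qmul a (qconj n) + qmul b m).

(* Iso_R(cayley R) is GL(8, R), acting on columns from the left, so that the
   product of matrices is the composition of maps. *)
Definition G2 (R : realType) : set 'M[R]_8 :=
  [set A | A \in unitmx /\
    forall x y : cayley R, A *m cmul x y = cmul (A *m x) (A *m y)].

Arguments G2 R : clear implicits.

(* Closed subgroup of GL(n, R); closedness is relative to GL(n, R). *)
Definition linear_lie_group (R : realType) (n : nat) (G : set 'M[R]_n.+1) :=
  [/\ G `<=` [set A | A \in unitmx],
      G 1%:M,
      forall A B, G A -> G B -> G (A *m B),
      forall A, G A -> G (invmx A) &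
      exists2 F : set 'M[R]_n.+1, closed F & G = F `&` [set A | A \in unitmx]].

Definition expmx (R : realType) (n : nat) (X : 'M[R]_n.+1) : 'M[R]_n.+1 :=
  limn (series (fun k => (k`!%:R)^-1 *: X ^+ k)).

(* The Lie algebra of a closed subgroup of GL(n, R); its bracket is the
   commutator of matrices. *)
Definition lie_algebra (R : realType) (n : nat) (G : set 'M[R]_n.+1)
    : set 'M[R]_n.+1 :=
  [set X | forall t : R, G (expmx (t *: X))].

Definition lie_bracket (R : realType) (n : nat) (X Y : 'M[R]_n.+1)
    : 'M[R]_n.+1 :=
  X *m Y - Y *m X.

Definition is_subspace (R : realType) (n : nat) (V : set 'M[R]_n.+1) :=
  V 0 /\ forall (c : R) X Y, V X -> V Y -> V (c *: X + Y).

Definition is_lie_subalgebra (R : realType) (n : nat) (g : set 'M[R]_n.+1) :=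
  is_subspace g /\ forall X Y, g X -> g Y -> g (lie_bracket X Y).

Definition is_lie_ideal (R : realType) (n : nat) (g h : set 'M[R]_n.+1) :=
  [/\ is_subspace h, h `<=` g &
      forall X Y, g X -> h Y -> h (lie_bracket X Y)].

Definition simple_lie_algebra (R : realType) (n : nat) (g : set 'M[R]_n.+1) :=
  [/\ is_lie_subalgebra g,
      exists X Y, [/\ g X, g Y & lie_bracket X Y != 0] &
      forall h, is_lie_ideal g h -> h = [set 0] \/ h = g].

Definition simple_lie_group (R : realType) (n : nat) (G : set 'M[R]_n.+1) :=
  [/\ linear_lie_group G, connected G & simple_lie_algebra (lie_algebra G)].

Definition is_path_in (R : realType) (T : topologicalType) (G : set T)
    (f : R -> T) (x y : T) :=
  [/\ {within `[0, 1], continuous f},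
      forall s, 0 <= s <= 1 -> G (f s), f 0 = x & f 1 = y].

Definition path_connected (R : realType) (T : topologicalType) (G : set T) :=
  G !=set0 /\
  forall x y, G x -> G y -> exists f : R -> T, is_path_in G f x y.

(* The loop f at x is homotopic in G to the constant loop, relatively to the
   base point; in h (s, t), s is the loop parameter and t the time. *)
Definition null_homotopic (R : realType) (T : topologicalType) (G : set T)
    (f : R -> T) (x : T) :=
  exists h : R * R -> T,
    [/\ {within `[0, 1] `*` `[0, 1], continuous h},
        forall s t, 0 <= s <= 1 -> 0 <= t <= 1 -> G (h (s, t)),
        forall s, 0 <= s <= 1 -> h (s, 0) = f s /\ h (s, 1) = x &
        forall t, 0 <= t <= 1 -> h (0, t) = x /\ h (1, t) = x].

Definition simply_connected (R : realType) (T : topologicalType) (G : set T) :=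
  path_connected R G /\
  forall (f : R -> T) x, is_path_in G f x x -> null_homotopic G f x.

(* Main.v *)
Require Import Defs.
From HB Require Import structures.
From mathcomp Require Import all_boot all_order all_algebra.
From mathcomp Require Import all_classical all_reals all_analysis.
From mathcomp Require Import ring lra.
Import numFieldNormedType.Exports.
Set Implicit Arguments.
Unset Strict Implicit.
Unset Printing Implicit Defensive.
Import Order.TTheory GRing.Theory Num.Theory.
Local Open Scope classical_set_scope.
Local Open Scope ring_scope.

(* A triple (a, b, c) of orthonormal imaginary octonions with c orthogonal to ab
   extends, by Cayley-Dickson doubling, to a unique automorphism mapping
   (e_1, e_2, e_4) to it, and every automorphism arises so. In particular
   automorphisms are orthogonal, which gives compactness.

   Sending an automorphism to the images of e_1, then of e_2, then of e_4 exhibits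
   G_2 as an iterated fibration with bases S^6, S^5, S^3 and trivial last fibre.
   Gram-Schmidt on triples lifts small displacements of the base points, hence
   paths and homotopies. A loop on such a sphere is homotopic to a piecewise linear
   one, which misses a point, so it contracts in a stereographic chart; lifting the
   contractions one base at a time shows that G_2 is simply connected.

   Comparing power series identifies the Lie algebra with the derivations. Write
   D_{a,b} for the inner derivation x |-> [[a,b],x] - 3[a,b,x], so that
   [X, D_{p,q}] = D_{Xp,q} + D_{p,Xq} for every derivation X. If X <> 0 lies in an
   ideal h, then X is skew on the 7-dimensional imaginary part and so kills some
   k <> 0; bracketing with D_{k,v} puts D_{k,Xv} in h with k orthogonal to Xv. If a
   and b are orthonormal and D_{a,b} is in h, then bracketing with D_{ab,q} puts all
   D_{ab,r} in h, and iterating yields all inner derivations, which span. *)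

(** A continuous loop may fill the whole sphere, so no pole can be chosen before the loop is
    replaced by a polygon. Each piece of a polygon is killed by a nonzero linear form in the last
    three coordinates, and a moment curve there escapes finitely many such forms, on all three
    spheres alike. Gluing along closed sets is avoided: paths and homotopies are total functions,
    and pieces are joined by adding clamped increments or by stopping a parameter. Lifting needs one
    radius valid on the whole group; Gram-Schmidt supplies 1/32, which eight coordinates turn into
    the tolerance 1/4 on inner products. On the algebraic side, the polarised composition law yields
    the doubling formula around any unit imaginary octonion, and the quadratic relation x^2 = 2
    Re(x) x - |x|^2 yields both orthogonality of automorphisms and skewness of derivations.
    Simplicity uses neither roots nor the Killing form; that inner derivations span comes from an
    explicit Casimir identity. *)

(* Both constants are locked so that matching a product never unfolds it to a
   matrix of coordinates. *)
Definition oct_def (R : realType) (a0 a1 a2 a3 a4 a5 a6 a7 : R) : 'cV[R]_8 :=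
  \col_(i < 8) [:: a0; a1; a2; a3; a4; a5; a6; a7]`_i.
HB.lock Definition oct := @oct_def.
Arguments oct {R}.

Definition omul_def (R : realType) (x y : 'cV[R]_8) : 'cV[R]_8 := cmul x y.
HB.lock Definition omul := @omul_def.
Arguments omul {R}.
Notation "x *o y" := (omul x y) (at level 40, left associativity).

Section Octonions.
Variable R : realType.
Implicit Types (x y z : 'cV[R]_8) (a b : R).

Lemma oct_coord a0 a1 a2 a3 a4 a5 a6 a7 i j :
  oct a0 a1 a2 a3 a4 a5 a6 a7 i j = [:: a0; a1; a2; a3; a4; a5; a6; a7]`_i.
Proof. by rewrite oct.unlock /oct_def mxE. Qed.

Definition ocoord x (k : nat) : R := x (inord k) ord0.

Lemma octE x :
  x = oct (ocoord x 0) (ocoord x 1) (ocoord x 2) (ocoord x 3)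
          (ocoord x 4) (ocoord x 5) (ocoord x 6) (ocoord x 7).
Proof.
apply/colP => i; rewrite oct_coord /ocoord -{1}(inord_val i).
by case: i => [] [|[|[|[|[|[|[|[|[]]]]]]]]] //= _.
Qed.

Lemma ocoord_oct a0 a1 a2 a3 a4 a5 a6 a7
    (u := oct a0 a1 a2 a3 a4 a5 a6 a7) :
  (((ocoord u 0 = a0) * (ocoord u 1 = a1)) * ((ocoord u 2 = a2) * (ocoord u 3 = a3)) *
   ((ocoord u 4 = a4) * (ocoord u 5 = a5)) * ((ocoord u 6 = a6) * (ocoord u 7 = a7)))%type.
Proof. by rewrite /u /ocoord !oct_coord !inordK. Qed.

Lemma omulE x y : omul x y = cmul x y.
Proof. by rewrite omul.unlock. Qed.

Lemma qcoordE (q0 q1 q2 q3 : R) : (qcoord (quat q0 q1 q2 q3) 0 = q0) *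
  (qcoord (quat q0 q1 q2 q3) 1 = q1) * (qcoord (quat q0 q1 q2 q3) 2 = q2) *
  (qcoord (quat q0 q1 q2 q3) 3 = q3).
Proof. by rewrite /qcoord /quat !mxE !inordK. Qed.

(** With the product given by eight explicit polynomials, octonion identities reduce to polynomial
    identities that [ring] decides coordinate by coordinate. *)
Lemma omul_oct a0 a1 a2 a3 a4 a5 a6 a7 b0 b1 b2 b3 b4 b5 b6 b7 :
  oct a0 a1 a2 a3 a4 a5 a6 a7 *o oct b0 b1 b2 b3 b4 b5 b6 b7 =
  oct (a0*b0 - a1*b1 - a2*b2 - a3*b3 - a4*b4 - a5*b5 - a6*b6 - a7*b7)
      (a0*b1 + a1*b0 + a2*b3 - a3*b2 + a4*b5 - a5*b4 - a6*b7 + a7*b6)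
      (a0*b2 - a1*b3 + a2*b0 + a3*b1 + a4*b6 + a5*b7 - a6*b4 - a7*b5)
      (a0*b3 + a1*b2 - a2*b1 + a3*b0 + a4*b7 - a5*b6 + a6*b5 - a7*b4)
      (a0*b4 - a1*b5 - a2*b6 - a3*b7 + a4*b0 + a5*b1 + a6*b2 + a7*b3)
      (a0*b5 + a1*b4 - a2*b7 + a3*b6 - a4*b1 + a5*b0 - a6*b3 + a7*b2)
      (a0*b6 + a1*b7 + a2*b4 - a3*b5 - a4*b2 + a5*b3 + a6*b0 - a7*b1)
      (a0*b7 - a1*b6 + a2*b5 + a3*b4 - a4*b3 - a5*b2 + a6*b1 + a7*b0).
Proof.
have E (u0 u1 u2 u3 u4 u5 u6 u7 : R) : oct u0 u1 u2 u3 u4 u5 u6 u7 =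
   col_mx (quat u0 u1 u2 u3) (quat u4 u5 u6 u7).
  apply/colP => i; rewrite oct_coord !mxE.
  by case: splitP => j ->; rewrite mxE; case: j => [] [|[|[|[|[]]]]].
rewrite !E omulE /cmul !col_mxKu !col_mxKd /qmul /qconj !qcoordE.
by apply: (congr2 (@col_mx R 4 4 1)); apply/colP => i; rewrite !mxE;
  case: i => [] [|[|[|[|[]]]]] //= _; ring.
Qed.

Lemma octD a0 a1 a2 a3 a4 a5 a6 a7 b0 b1 b2 b3 b4 b5 b6 b7 :
  oct a0 a1 a2 a3 a4 a5 a6 a7 + oct b0 b1 b2 b3 b4 b5 b6 b7 =
  oct (a0+b0) (a1+b1) (a2+b2) (a3+b3) (a4+b4) (a5+b5) (a6+b6) (a7+b7).
Proof.
by apply/colP => i; rewrite !(mxE, oct_coord); case: i => [] [|[|[|[|[|[|[|[|[]]]]]]]]].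
Qed.

Lemma octZ k a0 a1 a2 a3 a4 a5 a6 a7 :
  k *: oct a0 a1 a2 a3 a4 a5 a6 a7 =
  oct (k*a0) (k*a1) (k*a2) (k*a3) (k*a4) (k*a5) (k*a6) (k*a7).
Proof.
by apply/colP => i; rewrite !(mxE, oct_coord); case: i => [] [|[|[|[|[|[|[|[|[]]]]]]]]].
Qed.

Lemma octN a0 a1 a2 a3 a4 a5 a6 a7 :
  - oct a0 a1 a2 a3 a4 a5 a6 a7 =
  oct (-a0) (-a1) (-a2) (-a3) (-a4) (-a5) (-a6) (-a7).
Proof.
by apply/colP => i; rewrite !(mxE, oct_coord); case: i => [] [|[|[|[|[|[|[|[|[]]]]]]]]].
Qed.

Definition oconj x := oct (ocoord x 0) (- ocoord x 1) (- ocoord x 2) (- ocoord x 3) (- ocoord x 4)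
  (- ocoord x 5) (- ocoord x 6) (- ocoord x 7).

Definition dot x y : R := \sum_(i < 8) x i ord0 * y i ord0.
Definition oct1 : 'cV[R]_8 := oct 1 0 0 0 0 0 0 0.

Lemma dotE x y : dot x y =
  ocoord x 0 * ocoord y 0 + ocoord x 1 * ocoord y 1 + ocoord x 2 * ocoord y 2
  + ocoord x 3 * ocoord y 3 + ocoord x 4 * ocoord y 4 + ocoord x 5 * ocoord y 5
  + ocoord x 6 * ocoord y 6 + ocoord x 7 * ocoord y 7.
Proof.
rewrite /dot /ocoord !big_ord_recr big_ord0 /= add0r.
by do ![congr (_ + _)]; congr (x _ _ * y _ _); apply/val_inj; rewrite /= inordK.
Qed.

Definition der x y z : 'cV[R]_8 :=
  (x *o y - y *o x) *o z - z *o (x *o y - y *o x)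
  - 3%:R *: ((x *o y) *o z - x *o (y *o z)).

End Octonions.

Ltac oct_destruct x :=
  rewrite (octE x); generalize (ocoord x 0) (ocoord x 1) (ocoord x 2) (ocoord x 3) (ocoord x 4)
    (ocoord x 5) (ocoord x 6) (ocoord x 7); clear x; intros.
Ltac oct_simp :=
  rewrite /oct1 /oconj ?dotE !(omul_oct, octD, octZ, octN, ocoord_oct).
Ltac oct_ring := oct_simp; congr oct; ring.

Section LinearEntries.
Variable R : realType.
Implicit Types x y : 'cV[R]_8.

Lemma colD_entry x y i j : (x + y) i j = x i j + y i j.
Proof. by rewrite mxE. Qed.
Lemma colN_entry x i j : (- x) i j = - x i j.
Proof. by rewrite mxE. Qed.
Lemma colZ_entry (k : R) x i j : (k *: x) i j = k * x i j.
Proof. by rewrite mxE. Qed.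

End LinearEntries.

Definition mxlinE := (colD_entry, colN_entry, colZ_entry).

Ltac lin := apply/colP => ?; rewrite !mxlinE; ring.

(** * Octonion identities *)

Section OctonionIdentities.
Variable R : realType.
Implicit Types (x y z : 'cV[R]_8) (k : R).

Lemma omulDl x y z : (x + y) *o z = x *o z + y *o z.
Proof. by oct_destruct x; oct_destruct y; oct_destruct z; oct_ring. Qed.
Lemma omulDr x y z : z *o (x + y) = z *o x + z *o y.
Proof. by oct_destruct x; oct_destruct y; oct_destruct z; oct_ring. Qed.
Lemma omulZl k x y : (k *: x) *o y = k *: (x *o y).
Proof. by oct_destruct x; oct_destruct y; oct_ring. Qed.
Lemma omulZr k x y : x *o (k *: y) = k *: (x *o y).
Proof. by oct_destruct x; oct_destruct y; oct_ring. Qed.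
Lemma omulNl x y : (- x) *o y = - (x *o y).
Proof. by oct_destruct x; oct_destruct y; oct_ring. Qed.
Lemma omulNr x y : x *o (- y) = - (x *o y).
Proof. by oct_destruct x; oct_destruct y; oct_ring. Qed.
Lemma omul0l x : 0 *o x = 0.
Proof. by have := omulZl 0 0 x; rewrite !scale0r. Qed.
Lemma omul0r x : x *o 0 = 0.
Proof. by have := omulZr 0 x 0; rewrite !scale0r. Qed.
Lemma omul1l x : oct1 R *o x = x.
Proof. by oct_destruct x; oct_ring. Qed.
Lemma omul1r x : x *o oct1 R = x.
Proof. by oct_destruct x; oct_ring. Qed.

(** Polarisation of x (conj(x) z) = |x|^2 z. For orthogonal x and y the right side vanishes, so the
    two factors can be exchanged at the price of a sign. *)
Lemma omul_lin_l x y z :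
  x *o (oconj y *o z) + y *o (oconj x *o z) = (2%:R * dot x y) *: z.
Proof. by oct_destruct x; oct_destruct y; oct_destruct z; oct_ring. Qed.
Lemma omul_lin_r x y z :
  (z *o oconj x) *o y + (z *o oconj y) *o x = (2%:R * dot x y) *: z.
Proof. by oct_destruct x; oct_destruct y; oct_destruct z; oct_ring. Qed.
Lemma omul_alt_l x z : oconj x *o (x *o z) = dot x x *: z.
Proof. by oct_destruct x; oct_destruct z; oct_ring. Qed.
Lemma omul_alt_r x z : (z *o x) *o oconj x = dot x x *: z.
Proof. by oct_destruct x; oct_destruct z; oct_ring. Qed.
Lemma oconjM x y : oconj (x *o y) = oconj y *o oconj x.
Proof. by oct_destruct x; oct_destruct y; oct_ring. Qed.
Lemma oconjD x y : oconj (x + y) = oconj x + oconj y.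
Proof. by oct_destruct x; oct_destruct y; oct_ring. Qed.
Lemma oconjZ k x : oconj (k *: x) = k *: oconj x.
Proof. by oct_destruct x; oct_ring. Qed.
Lemma oconj1 : oconj (oct1 R) = oct1 R.
Proof. by oct_ring. Qed.
Lemma oconjE x : oconj x = (2%:R * ocoord x 0) *: oct1 R - x.
Proof. by oct_destruct x; oct_ring. Qed.
Lemma oconj_imag x : ocoord x 0 = 0 -> oconj x = - x.
Proof. by move=> x0; rewrite oconjE x0 mulr0 scale0r sub0r. Qed.
Lemma osqr x : x *o x = (2%:R * ocoord x 0) *: x - dot x x *: oct1 R.
Proof. by oct_destruct x; oct_ring. Qed.

Lemma ocoordD x y n : ocoord (x + y) n = ocoord x n + ocoord y n.
Proof. by rewrite /ocoord mxE. Qed.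
Lemma ocoordZ k x n : ocoord (k *: x) n = k * ocoord x n.
Proof. by rewrite /ocoord mxE. Qed.
Lemma ocoordN x n : ocoord (- x) n = - ocoord x n.
Proof. by rewrite /ocoord mxE. Qed.
Lemma ocoord0 n : ocoord (0 : 'cV[R]_8) n = 0.
Proof. by rewrite /ocoord mxE. Qed.

Lemma dotC x y : dot x y = dot y x.
Proof. by rewrite !dotE; ring. Qed.
Lemma dotDl x y z : dot (x + y) z = dot x z + dot y z.
Proof. by rewrite !dotE !ocoordD; ring. Qed.
Lemma dotZl k x z : dot (k *: x) z = k * dot x z.
Proof. by rewrite !dotE !ocoordZ; ring. Qed.
Lemma dotNl x z : dot (- x) z = - dot x z.
Proof. by rewrite !dotE !ocoordN; ring. Qed.
Lemma dotDr x y z : dot z (x + y) = dot z x + dot z y.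
Proof. by rewrite !(dotC z) dotDl. Qed.
Lemma dotZr k x z : dot z (k *: x) = k * dot z x.
Proof. by rewrite !(dotC z) dotZl. Qed.
Lemma dotNr x z : dot z (- x) = - dot z x.
Proof. by rewrite !(dotC z) dotNl. Qed.
Lemma dot0l x : dot 0 x = 0.
Proof. by have := dotZl 0 0 x; rewrite scale0r mul0r. Qed.
Lemma dot1 x : dot (oct1 R) x = ocoord x 0.
Proof. by rewrite dotE /oct1 !ocoord_oct; ring. Qed.
Lemma dot_ge0 x : 0 <= dot x x.
Proof. by apply: sumr_ge0 => i _; rewrite -expr2 sqr_ge0. Qed.
Lemma dot_eq0 x : dot x x = 0 -> x = 0.
Proof.
move=> /eqP; rewrite psumr_eq0 => [/allP h|i _]; last by rewrite -expr2 sqr_ge0.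
apply/colP => i; apply/eqP; rewrite mxE -sqrf_eq0 expr2.
by apply: h; rewrite mem_index_enum.
Qed.
Lemma dot_mull x y z : dot (x *o y) z = dot y (oconj x *o z).
Proof.
oct_destruct x; oct_destruct y; oct_destruct z; oct_simp; ring.
Qed.
Lemma dot_mulr x y z : dot (x *o y) z = dot x (z *o oconj y).
Proof.
oct_destruct x; oct_destruct y; oct_destruct z; oct_simp; ring.
Qed.
Lemma dot_norm x y : dot (x *o y) (x *o y) = dot x x * dot y y.
Proof. by oct_destruct x; oct_destruct y; oct_simp; ring. Qed.
Lemma dot_oconj x y : dot (oconj x) (oconj y) = dot x y.
Proof. by rewrite !dotE /oconj !ocoord_oct; ring. Qed.
Lemma ocoord_mul x y : ocoord (x *o y) 0 = dot (oconj x) y.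
Proof. by oct_destruct x; oct_destruct y; oct_simp; ring. Qed.

(** The real part of [x *o y] is [- dot x y = 0], so conjugation negates the product; conjugation
    also reverses it, and the signs of the two imaginary factors cancel. *)
Lemma omul_anti x y : ocoord x 0 = 0 -> ocoord y 0 = 0 -> dot x y = 0 ->
  y *o x = - (x *o y).
Proof.
move=> x0 y0 xy; have := oconjM x y.
rewrite oconj_imag; last by rewrite ocoord_mul oconj_imag // dotNl xy oppr0.
by rewrite (oconj_imag x0) (oconj_imag y0) omulNl omulNr opprK.
Qed.

(** * Cayley-Dickson doubling around an imaginary octonion *)

Section Doubling.
Variable c : 'cV[R]_8.
Hypothesis c0 : ocoord c 0 = 0.

Let ocjc : oconj c = - c. Proof. exact: oconj_imag. Qed.

Lemma omul_swap x : dot x c = 0 -> x *o c = c *o oconj x.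
Proof.
move=> xc; have := omul_lin_l x c (oct1 R); rewrite xc mulr0 scale0r !omul1r ocjc.
by rewrite omulNr => /eqP; rewrite addr_eq0 eqr_opp => /eqP.
Qed.

(** Turn [y *o c] into [c *o oconj y], exchange [x] and [c] by the polarised law, then move [c] back
    to the right. *)
Lemma doubling_l x y : dot x c = 0 -> dot y c = 0 -> dot (y *o x) c = 0 ->
  x *o (y *o c) = (y *o x) *o c.
Proof.
move=> xc yc yxc; rewrite (omul_swap yc) (omul_swap yxc) oconjM.
have := omul_lin_l x c (oconj y); rewrite xc mulr0 scale0r ocjc omulNl omulNr.
by rewrite addrC => /eqP; rewrite subr_eq0 => /eqP <-.
Qed.

Lemma doubling_r x y : dot y c = 0 -> (x *o c) *o y = (x *o oconj y) *o c.
Proof.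
move=> yc; have := omul_lin_r y c x; rewrite yc mulr0 scale0r ocjc.
by rewrite omulNr omulNl => /eqP; rewrite subr_eq0 => /eqP <-.
Qed.

(** Polarising in [c] and [y *o c], whose inner product is Re(y), leaves y x - 2 Re(y) x, which is -
    conj(y) x. *)
Lemma doubling_lr x y : dot c c = 1 ->
  dot x c = 0 -> dot y c = 0 -> dot (y *o x) c = 0 ->
  (x *o c) *o (y *o c) = - (oconj y *o x).
Proof.
move=> cc xc yc yxc.
have w0 : ocoord (y *o c) 0 = 0 by rewrite ocoord_mul -[c]opprK -ocjc dotNr dot_oconj yc oppr0.
have cw : dot c (y *o c) = ocoord y 0.
  by rewrite dotC dot_mulr ocjc omulNr osqr c0 cc mulr0 scale0r scale1r sub0r
    opprK dotC dot1.
have cK z : (z *o c) *o c = - z.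
  have := omul_lin_r c c z; rewrite cc ocjc omulNr omulNl => e.
  by apply/colP => i; move/colP/(_ i): e; rewrite !mxE; lra.
have := omul_lin_r c (y *o c) x; rewrite ocjc cw (oconj_imag w0) !omulNr !omulNl.
rewrite (doubling_l xc yc yxc) cK opprK oconjE omulDl omulZl omul1l omulNl => e.
have {e}-> : x *o c *o (y *o c) = y *o x - (2%:R * ocoord y 0) *: x.
  by rewrite -e opprD opprK addrCA subrr addr0.
by rewrite opprD opprK addrC.
Qed.

(** This is the defining product of the Cayley algebra with [c] in place of e_4; the last two
    orthogonality hypotheses stand for closure of a quaternion subalgebra orthogonal to [c]. *)
Lemma doubling_mul p q x y : dot c c = 1 ->
  dot p c = 0 -> dot q c = 0 -> dot x c = 0 -> dot y c = 0 ->
  dot (y *o p) c = 0 -> dot (y *o q) c = 0 ->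
  (p + q *o c) *o (x + y *o c) =
  (p *o x - oconj y *o q) + (q *o oconj x + y *o p) *o c.
Proof.
move=> cc pc qc xc yc ypc yqc; rewrite omulDr !omulDl (doubling_l pc yc ypc).
rewrite (doubling_r _ xc) (doubling_lr cc qc yc yqc) -!addrA.
by congr (_ + _); rewrite addrA addrC.
Qed.

End Doubling.
End OctonionIdentities.

(** * Basic triples and automorphisms *)

Section Triples.
Variable R : realType.
Implicit Types (x y z a b c : 'cV[R]_8) (k : R) (A : 'M[R]_8).

Definition e1 : 'cV[R]_8 := oct 0 1 0 0 0 0 0 0.
Definition e2 : 'cV[R]_8 := oct 0 0 1 0 0 0 0 0.
Definition e4 : 'cV[R]_8 := oct 0 0 0 0 1 0 0 0.

Definition imag_unit x := ocoord x 0 = 0 /\ dot x x = 1.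

Definition triple a b c := [/\ imag_unit a, imag_unit b, imag_unit c, dot a b = 0 &
  [/\ dot a c = 0, dot b c = 0 & dot (a *o b) c = 0]].

Definition quat_span a b (q0 q1 q2 q3 : R) :=
  q0 *: oct1 R + q1 *: a + q2 *: b + q3 *: (a *o b).

Lemma imag_unit_sqr a : imag_unit a -> a *o a = - oct1 R.
Proof. by case=> a0 aa; rewrite osqr a0 aa mulr0 scale0r scale1r sub0r. Qed.

Lemma imag_unit_altl a x : imag_unit a -> a *o (a *o x) = - x.
Proof.
case=> a0 aa; have := omul_alt_l a x.
by rewrite (oconj_imag a0) aa scale1r omulNl => /(canRL opprK).
Qed.

Lemma imag_unit_altr a x : imag_unit a -> (x *o a) *o a = - x.
Proof.
case=> a0 aa; have := omul_alt_r a x.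
by rewrite (oconj_imag a0) aa scale1r omulNr => /(canRL opprK).
Qed.

Section Pair.
Variables a b : 'cV[R]_8.
Hypotheses (ia : imag_unit a) (ib : imag_unit b) (ab : dot a b = 0).

Lemma imag_unit_mul : imag_unit (a *o b).
Proof.
case: (ia) (ib) => a0 aa [b0 bb]; split; last by rewrite dot_norm aa bb mulr1.
by rewrite ocoord_mul oconj_imag // dotNl ab oppr0.
Qed.

Lemma dot_mul_self : dot a (a *o b) = 0 /\ dot b (a *o b) = 0.
Proof.
case: (ia) (ib) => a0 aa [b0 bb]; split; rewrite dotC.
  by rewrite dot_mull oconj_imag // omulNl imag_unit_sqr // opprK dotC dot1.
by rewrite dot_mulr oconj_imag // omulNr imag_unit_sqr // opprK dotC dot1.
Qed.

Lemma pair_table :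
  (((b *o a = - (a *o b)) * (a *o (a *o b) = - b)) *
   (((a *o b) *o a = b) * (b *o (a *o b) = a)) *
   ((a *o b) *o b = - a) * ((a *o b) *o (a *o b) = - oct1 R) *
   ((a *o a = - oct1 R) * (b *o b = - oct1 R)))%type.
Proof.
have [[a0 aa] [b0 bb]] := (ia, ib).
have ba : b *o a = - (a *o b) by exact: omul_anti.
do !split => //; rewrite ?imag_unit_sqr ?imag_unit_altl ?imag_unit_altr //; last exact: imag_unit_mul.
  by rewrite -[LHS]opprK -omulNl -ba imag_unit_altr // opprK.
by rewrite -[LHS]opprK -omulNr -ba imag_unit_altl // opprK.
Qed.

Lemma quat_spanM p0 p1 p2 p3 q0 q1 q2 q3 :
  quat_span a b p0 p1 p2 p3 *o quat_span a b q0 q1 q2 q3 =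
  quat_span a b (p0 * q0 - p1 * q1 - p2 * q2 - p3 * q3)
                (p0 * q1 + p1 * q0 + p2 * q3 - p3 * q2)
                (p0 * q2 - p1 * q3 + p2 * q0 + p3 * q1)
                (p0 * q3 + p1 * q2 - p2 * q1 + p3 * q0).
Proof.
rewrite /quat_span !(omulDl, omulDr) !(omulZl, omulZr) !(omul1l, omul1r).
by rewrite !pair_table; lin.
Qed.

Lemma oconj_quat_span q0 q1 q2 q3 :
  oconj (quat_span a b q0 q1 q2 q3) = quat_span a b q0 (- q1) (- q2) (- q3).
Proof.
have [[[a0 _] [b0 _]] [ab0 _]] := (ia, ib, imag_unit_mul).
rewrite /quat_span !oconjD !oconjZ oconj1 (oconj_imag a0) (oconj_imag b0) (oconj_imag ab0).
by rewrite !scalerN !scaleNr.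
Qed.

End Pair.

Lemma dot_quat_span a b c q0 q1 q2 q3 : triple a b c ->
  dot (quat_span a b q0 q1 q2 q3) c = 0.
Proof.
case=> ia ib [c0 cc] ab [ac bc abc].
by rewrite /quat_span !dotDl !dotZl dot1 c0 ac bc abc !mulr0 !addr0.
Qed.

(** The columns are the forced images of 1, e_1, e_2, e_3 and of e_4, e_5 = e_1 e_4, e_6 = e_2 e_4,
    e_7 = e_3 e_4 once e_1, e_2, e_4 go to [a], [b], [c]. *)
Definition triple_mx a b c : 'M[R]_8 := \matrix_(i, j)
  [:: oct1 R; a; b; a *o b; c; a *o c; b *o c; (a *o b) *o c]`_j i ord0.

Lemma mulmx_co A x : A *m x = ocoord x 0 *: col (inord 0) A + ocoord x 1 *: col (inord 1) A
  + ocoord x 2 *: col (inord 2) A + ocoord x 3 *: col (inord 3) A + ocoord x 4 *: col (inord 4) A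
  + ocoord x 5 *: col (inord 5) A + ocoord x 6 *: col (inord 6) A + ocoord x 7 *: col (inord 7) A.
Proof.
apply/colP => i; rewrite mxE !big_ord_recr big_ord0 /= add0r !mxE.
do ![congr (_ + _)]; rewrite mulrC; congr (x _ _ * A _ _);
  by apply/val_inj; rewrite /= inordK.
Qed.

Lemma triple_mx_oct a b c (x0 x1 x2 x3 x4 x5 x6 x7 : R) :
  triple_mx a b c *m oct x0 x1 x2 x3 x4 x5 x6 x7 =
  quat_span a b x0 x1 x2 x3 + quat_span a b x4 x5 x6 x7 *o c.
Proof.
rewrite mulmx_co !ocoord_oct /quat_span !(omulDl, omulZl) omul1l.
by apply/colP => i; rewrite !mxE !inordK //=; ring.
Qed.

Lemma triple_mxM a b c x y : triple a b c ->
  triple_mx a b c *m (x *o y) = (triple_mx a b c *m x) *o (triple_mx a b c *m y).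
Proof.
move=> t; case: (t) => ia ib [c0 cc] ab _.
oct_destruct x; oct_destruct y; rewrite omul_oct !triple_mx_oct.
have sc := dot_quat_span _ _ _ _ t.
rewrite (doubling_mul c0 cc) ?quat_spanM ?sc // !oconj_quat_span // !quat_spanM //.
rewrite /quat_span !(omulDl, omulZl, omul1l); lin.
Qed.


Definition multiplicative A := forall x y, A *m (x *o y) = (A *m x) *o (A *m y).

(** A multiplicative map preserves the relation x^2 = 2 Re(x) x - |x|^2, from which the norm can be
    read off. Invertibility of [A] is a consequence, drawn in [G2P]. *)
Lemma mulmx_mult_dot A x y : A *m oct1 R = oct1 R -> multiplicative A ->
  dot (A *m x) (A *m y) = dot x y.
Proof.
move=> A1 AM.
have im z : ocoord z 0 = 0 -> ocoord (A *m z) 0 = 0 /\ dot (A *m z) (A *m z) = dot z z.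
  move=> z0; set w := A *m z.
  have e : (2%:R * ocoord w 0) *: w - dot w w *: oct1 R = - dot z z *: oct1 R.
    by rewrite -osqr -AM osqr z0 mulr0 scale0r sub0r -scaleNr -scalemxAr A1.
  have e0 : 2%:R * ocoord w 0 * ocoord w 0 - dot w w = - dot z z.
    have := congr1 (fun v => dot (oct1 R) v) e.
    by rewrite dotDr dotNr !dotZr !dot1 /oct1 !ocoord_oct !mulr1.
  have ew : ocoord w 0 * (dot w w + dot z z) = 0.
    have := congr1 (dot w) e.
    by rewrite dotDr dotNr !dotZr (dotC _ (oct1 R)) !dot1 => h; lra.
  suff w0 : ocoord w 0 = 0 by split=> //; move: e0; rewrite w0; lra.
  (* If the second factor vanishes, so do both squared norms, and then [w] is zero anyway. *)
  move/eqP: ew; rewrite mulf_eq0 => /orP[/eqP //|/eqP sw].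
  have := dot_ge0 w; have := dot_ge0 z => z2 w2.
  have /dot_eq0 -> : dot w w = 0 by lra.
  by rewrite ocoord0.
have normalize z : dot (A *m z) (A *m z) = dot z z.
  pose u := z - ocoord z 0 *: oct1 R.
  have u0 : ocoord u 0 = 0 by rewrite ocoordD ocoordN ocoordZ /oct1 !ocoord_oct mulr1 subrr.
  have [Au0 Auu] := im _ u0.
  have -> : z = ocoord z 0 *: oct1 R + u by rewrite addrC subrK.
  move: u u0 Au0 Auu => u u0 Au0 Auu.
  rewrite mulmxDr -scalemxAr A1 !(dotDl, dotDr) !(dotZl, dotZr) Auu.
  by rewrite (dotC u (oct1 R)) (dotC (A *m u) (oct1 R)) !dot1 Au0 u0.
have := normalize (x + y); rewrite mulmxDr !(dotDl, dotDr) !normalize.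
by rewrite (dotC (A *m y)) (dotC y x); lra.
Qed.

Lemma dotmxE x y : dot x y = (x^T *m y) ord0 ord0.
Proof.
by rewrite mxE; apply: eq_bigr => i _; rewrite mxE.
Qed.

Lemma dot_orthogonal A : (forall x y, dot (A *m x) (A *m y) = dot x y) ->
  A^T *m A = 1%:M.
Proof.
move=> h; apply/matrixP => i j.
have := h (delta_mx i 0) (delta_mx j 0).
rewrite !dotmxE trmx_mul !trmx_delta mulmxA -(mulmxA (delta_mx 0 i)).
rewrite -rowE -colE mul_delta_mx_cond => e; rewrite [RHS]mxE.
have -> : (A^T *m A) i j = (col j (row i (A^T *m A))) 0 0 by rewrite [RHS]mxE [RHS]mxE.
by rewrite e; case: eqP => _; rewrite !(mulr1n, mulr0n) mxE ?eqxx.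
Qed.

Lemma G2P A : G2 R A <-> A *m oct1 R = oct1 R /\ multiplicative A.
Proof.
split=> [[uA AM]|[A1 AM]].
  have {}AM : multiplicative A by move=> x y; rewrite !omulE.
  (* Multiplicativity at 1 and the preimage of 1 reads 1 = (A 1) 1. *)
  split=> //; have := AM (oct1 R) (invmx A *m oct1 R).
  by rewrite omul1l !mulmxA mulmxV // mul1mx omul1r => <-.
split=> [|x y]; last by rewrite -!omulE.
have /mulmx1_unit[] := dot_orthogonal (fun x y => mulmx_mult_dot x y A1 AM).
by [].
Qed.

Lemma G2_dot A x y : G2 R A -> dot (A *m x) (A *m y) = dot x y.
Proof. by case/G2P => ? ?; exact: mulmx_mult_dot. Qed.

Lemma G2_orthogonal A : G2 R A -> A^T *m A = 1%:M.
Proof. by move=> gA; apply: dot_orthogonal => x y; exact: G2_dot. Qed.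

Lemma G2M A x y : G2 R A -> A *m (x *o y) = (A *m x) *o (A *m y).
Proof. by case/G2P => _; exact. Qed.

Lemma G2_one A : G2 R A -> A *m oct1 R = oct1 R.
Proof. by case/G2P. Qed.

Lemma G2_co0 A x : G2 R A -> ocoord (A *m x) 0 = ocoord x 0.
Proof. by move=> gA; rewrite -!dot1 -{1}(G2_one gA) G2_dot. Qed.

Lemma G2_mulmx A B : G2 R A -> G2 R B -> G2 R (A *m B).
Proof.
move=> gA gB; apply/G2P; split=> [|x y]; first by rewrite -mulmxA !G2_one.
by rewrite -!mulmxA !G2M.
Qed.

Lemma G2_1 : G2 R 1%:M.
Proof. by apply/G2P; split=> [|x y]; rewrite !mul1mx. Qed.

Lemma G2_unit A : G2 R A -> A \in unitmx. Proof. by case. Qed.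

Lemma G2_inv A : G2 R A -> G2 R (invmx A).
Proof.
move=> gA; have uA := G2_unit gA; apply/G2P; split=> [|x y].
  by rewrite -{1}(G2_one gA) mulKmx.
by apply: (canLR (mulKmx uA)); rewrite G2M // !mulKVmx.
Qed.

Lemma triple_basis : triple e1 e2 e4.
Proof.
by split; rewrite /imag_unit /e1 /e2 /e4; oct_simp; do ?split; rewrite /=; ring.
Qed.

Lemma G2_imag_unit A x : G2 R A -> imag_unit x -> imag_unit (A *m x).
Proof. by move=> gA [x0 xx]; split; rewrite ?G2_co0 ?G2_dot. Qed.

Lemma G2_triple A a b c : G2 R A -> triple a b c ->
  triple (A *m a) (A *m b) (A *m c).
Proof.
move=> gA [ia ib ic ab [ac bc abc]].
by split; rewrite -?G2M // ?G2_dot //; apply: G2_imag_unit.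
Qed.

Lemma mulmx_triple_mx A a b c : G2 R A ->
  A *m triple_mx a b c = triple_mx (A *m a) (A *m b) (A *m c).
Proof.
move=> gA; apply/matrixP => i j.
have -> : (A *m triple_mx a b c) i j = (A *m col j (triple_mx a b c)) i ord0.
  by rewrite [LHS]mxE [RHS]mxE; apply: eq_bigr => k _; rewrite [in RHS]mxE.
rewrite mxE [in RHS]/triple_mx [RHS]mxE.
have -> : col j (triple_mx a b c) = [:: oct1 R; a; b; a *o b; c; a *o c; b *o c;
    (a *o b) *o c]`_j by apply/colP => k; rewrite !mxE.
rewrite -!G2M // -{2}(G2_one gA).
by case: j => [] [|[|[|[|[|[|[|[|[]]]]]]]]] //= _; rewrite mxE.
Qed.

Lemma triple_mx_basis : triple_mx e1 e2 e4 = 1%:M.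
Proof.
apply/matrixP => i j; rewrite !mxE /e1 /e2 /e4 /oct1 !omul_oct.
case: j => [] [|[|[|[|[|[|[|[|[]]]]]]]]] //= ?; rewrite oct_coord;
  case: i => [] [|[|[|[|[|[|[|[|[]]]]]]]]] //= ?; ring.
Qed.

Lemma G2_triple_mxE A : G2 R A -> A = triple_mx (A *m e1) (A *m e2) (A *m e4).
Proof. by move=> gA; rewrite -mulmx_triple_mx // triple_mx_basis mulmx1. Qed.

Lemma triple_mx_G2 a b c : triple a b c -> G2 R (triple_mx a b c).
Proof.
move=> t; apply/G2P; split=> [|x y]; last exact: triple_mxM.
rewrite /oct1 triple_mx_oct /quat_span !scale0r !scale1r !addr0 omul0l.
by rewrite addr0.
Qed.

Lemma triple_mx_e1 a b c : triple_mx a b c *m e1 = a.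
Proof. by rewrite triple_mx_oct /quat_span !scale0r scale1r !addr0 add0r omul0l addr0. Qed.
Lemma triple_mx_e2 a b c : triple_mx a b c *m e2 = b.
Proof. by rewrite triple_mx_oct /quat_span !scale0r scale1r !addr0 !add0r omul0l addr0. Qed.
Lemma triple_mx_e4 a b c : triple_mx a b c *m e4 = c.
Proof. by rewrite triple_mx_oct /quat_span !scale0r scale1r !addr0 add0r omul1l. Qed.

End Triples.

(** * Continuity and compactness *)

Section MatrixLimits.
Variable R : realType.

Lemma cvg_mx (T : Type) (F : set_system T) {FF : Filter F} m n
    (f : T -> 'M[R]_(m, n)) (a : 'M[R]_(m, n)) :
  (forall i j, f z i j @[z --> F] --> a i j) -> f z @[z --> F] --> a.
Proof.
move=> h A [P aP sPA]; rewrite nbhs_filterE.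
have: \forall z \near F, forall i, forall j, P i j (f z i j).
  exact: (filter_forall FF (fun i => filter_forall FF (fun j => h i j _ (aP i j)))).
by apply: filterS => z Pz; exact: sPA.
Qed.

Lemma cvg_entry (T : Type) (F : set_system T) {FF : Filter F} m n
    (f : T -> 'M[R]_(m, n)) (a : 'M[R]_(m, n)) i j :
  f z @[z --> F] --> a -> f z i j @[z --> F] --> a i j.
Proof.
move=> fa; apply: (cvg_comp f (fun M : 'M[R]_(m, n) => M i j) fa).
exact: coord_continuous.
Qed.

Lemma cvg_finsum (V : normedModType R) (T : Type) (F : set_system T)
    {FF : Filter F} (I : finType) (f : I -> T -> V) (a : I -> V) :
  (forall i, f i z @[z --> F] --> a i) ->
  \sum_i f i z @[z --> F] --> \sum_i a i.
Proof. by move=> h; apply: cvg_big => [|i _]; [exact: add_continuous|exact: h]. Qed.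

Lemma cvg_mulmx (T : Type) (F : set_system T) {FF : Filter F} m n p
    (f : T -> 'M[R]_(m, n)) (g : T -> 'M[R]_(n, p)) (a : 'M[R]_(m, n)) (b : 'M[R]_(n, p)) :
  f z @[z --> F] --> a -> g z @[z --> F] --> b ->
  f z *m g z @[z --> F] --> a *m b.
Proof.
move=> fa gb; apply: cvg_mx => i j.
have -> : (fun z => (f z *m g z) i j) = (fun z => \sum_k f z i k * g z k j).
  by apply/funext => z; rewrite mxE.
by rewrite mxE; apply: cvg_finsum => k; apply: cvgM; exact: cvg_entry.
Qed.

Lemma omul_suml (I : Type) (r : seq I) (P : pred I) (f : I -> 'cV[R]_8) z :
  (\sum_(i <- r | P i) f i) *o z = \sum_(i <- r | P i) f i *o z.
Proof. exact: (big_morph (fun u => u *o z) (fun u v => omulDl u v z) (omul0l z)). Qed.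

Lemma omul_sumr (I : Type) (r : seq I) (P : pred I) (f : I -> 'cV[R]_8) z :
  z *o (\sum_(i <- r | P i) f i) = \sum_(i <- r | P i) z *o f i.
Proof. exact: (big_morph (fun u => z *o u) (fun u v => omulDr u v z) (omul0r z)). Qed.

(** Bilinearity reduces continuity of [*o] to that of products of entries, whatever the structure
    constants are. *)
Lemma omul_sum_delta (x y : 'cV[R]_8) :
  x *o y = \sum_k \sum_l (x k 0 * y l 0) *: (delta_mx k 0 *o delta_mx l 0).
Proof.
have sd (u : 'cV[R]_8) : u = \sum_k u k 0 *: delta_mx k 0.
  rewrite {1}(matrix_sum_delta u); apply: eq_bigr => k _.
  by rewrite big_ord_recl big_ord0 addr0.
rewrite {1}(sd x) {1}(sd y) omul_suml; apply: eq_bigr => k _.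
rewrite omul_sumr; apply: eq_bigr => l _.
by rewrite omulZl omulZr scalerA.
Qed.

Lemma cvg_omul (T : Type) (F : set_system T) {FF : Filter F}
    (f g : T -> 'cV[R]_8) (a b : 'cV[R]_8) :
  f z @[z --> F] --> a -> g z @[z --> F] --> b ->
  f z *o g z @[z --> F] --> a *o b.
Proof.
move=> fa gb.
have -> : (fun z => f z *o g z) = (fun z => \sum_k \sum_l
   (f z k 0 * g z l 0) *: (delta_mx k 0 *o delta_mx l 0)).
  by apply/funext => z; rewrite omul_sum_delta.
rewrite omul_sum_delta; apply: cvg_finsum => k; apply: cvg_finsum => l.
by apply: cvgZr_tmp; apply: cvgM; exact: cvg_entry.
Qed.

Lemma cvg_dot (T : Type) (F : set_system T) {FF : Filter F}
    (f g : T -> 'cV[R]_8) (a b : 'cV[R]_8) :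
  f z @[z --> F] --> a -> g z @[z --> F] --> b ->
  dot (f z) (g z) @[z --> F] --> dot a b.
Proof.
by move=> fa gb; apply: cvg_finsum => k; apply: cvgM; exact: cvg_entry.
Qed.

Section ContinuousAt.
Variables (T : topologicalType) (x : T).

Lemma cts_mx m n (f : T -> 'M[R]_(m, n)) :
  (forall i j, {for x, continuous (fun z => f z i j)}) -> {for x, continuous f}.
Proof. by move=> h; apply: cvg_mx. Qed.

Lemma cts_finsum (V : normedModType R) (I : finType) (f : I -> T -> V) :
  (forall i, {for x, continuous (f i)}) ->
  {for x, continuous (fun z => \sum_i f i z)}.
Proof. by move=> h; apply: cvg_finsum. Qed.

Lemma cts_entry m n (f : T -> 'M[R]_(m, n)) i j :
  {for x, continuous f} -> {for x, continuous (fun z => f z i j)}.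
Proof. by move=> cf; apply: cvg_entry. Qed.

Lemma cts_mulmx m n p (f : T -> 'M[R]_(m, n)) (g : T -> 'M[R]_(n, p)) :
  {for x, continuous f} -> {for x, continuous g} ->
  {for x, continuous (fun z => f z *m g z)}.
Proof. by move=> cf cg; apply: cvg_mulmx. Qed.

Lemma cts_omul (f g : T -> 'cV[R]_8) :
  {for x, continuous f} -> {for x, continuous g} ->
  {for x, continuous (fun z => f z *o g z)}.
Proof. by move=> cf cg; apply: cvg_omul. Qed.

Lemma cts_dot (f g : T -> 'cV[R]_8) :
  {for x, continuous f} -> {for x, continuous g} ->
  {for x, continuous (fun z => dot (f z) (g z))}.
Proof. by move=> cf cg; apply: cvg_dot. Qed.

End ContinuousAt.

Lemma cts_id (T : topologicalType) (x : T) : {for x, continuous (fun z : T => z)}.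
Proof. exact: cvg_id. Qed.

Lemma cts_cst (T U : topologicalType) (x : T) (c : U) :
  {for x, continuous (fun=> c)}.
Proof. exact: cvg_cst. Qed.

End MatrixLimits.
Arguments cts_id {T} x.
Arguments cts_cst {T U} x c.

Section Compactness.
Variable R : realType.

Lemma closed_eq_fun (T : topologicalType) (U : normedModType R) (f g : T -> U) :
  (forall x, {for x, continuous f}) -> (forall x, {for x, continuous g}) ->
  closed [set x | f x = g x].
Proof.
move=> cf cg.
have -> : [set x | f x = g x] = (fun x => f x - g x) @^-1` [set 0].
  by apply/seteqP; split=> x /= => [->|/eqP]; rewrite ?subrr // subr_eq0 => /eqP.
apply: closed_comp => [x _|]; last first.
  exact/accessible_closed_set1/hausdorff_accessible/norm_hausdorff.
by apply: cvgB; [exact: cf|exact: cg].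
Qed.

Lemma closed_multiplicative : closed [set A : 'M[R]_8 | multiplicative A].
Proof.
have -> : [set A : 'M[R]_8 | multiplicative A] =
    \bigcap_(v in [set: 'cV[R]_8 * 'cV[R]_8])
    [set A | A *m (v.1 *o v.2) = (A *m v.1) *o (A *m v.2)].
  apply/seteqP; split=> A /=; first by move=> h v _; exact: h.
  by move=> h x y; exact: (h (x, y)).
apply: closed_bigI => v _; apply: closed_eq_fun => A.
  by apply: cts_mulmx; [exact: cts_id|exact: cts_cst].
by apply: cts_omul; apply: cts_mulmx; (exact: cts_id || exact: cts_cst).
Qed.

Lemma closed_G2 : closed (G2 R).
Proof.
have -> : G2 R = [set A | A *m oct1 R = oct1 R] `&` [set A | multiplicative A].
  by apply/seteqP; split=> A /G2P.
apply: closedI; last exact: closed_multiplicative.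
apply: closed_eq_fun => A; last exact: cts_cst.
by apply: cts_mulmx; [exact: cts_id|exact: cts_cst].
Qed.

(** Each column of an orthogonal matrix is a unit vector. *)
Lemma G2_entry (A : 'M[R]_8) i j : G2 R A -> `|A i j| <= 1.
Proof.
move=> /G2_orthogonal /matrixP /(_ j j); rewrite !mxE eqxx.
rewrite (bigD1 i) //= mxE => e.
have s0 : 0 <= \sum_(k | k != i) A^T j k * A k j.
  by apply: sumr_ge0 => k _; rewrite mxE -expr2 sqr_ge0.
by rewrite ler_norml; apply/andP; split; nra.
Qed.

Lemma compact_G2 : compact (G2 R).
Proof.
(* Heine-Borel is applied to row vectors of length 64, and compactness is carried over by the
   continuous map [vec_mx]. *)
have -> : G2 R = (fun v : 'rV[R]_(8 * 8) => vec_mx v) @` [set v | G2 R (vec_mx v)].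
  apply/seteqP; split=> [A gA|_ [v gv <-]//].
  by exists (mxvec A); rewrite /= mxvecK.
have cv v : {for v, continuous (fun v : 'rV[R]_(8 * 8) => vec_mx v : 'M[R]_8)}.
  apply: cts_mx => i j.
  have -> : (fun w : 'rV[R]_(8 * 8) => vec_mx w i j) = (fun w => w 0 (mxvec_index i j)).
    by apply/funext => w; rewrite mxE.
  by apply: cts_entry; exact: cts_id.
apply: continuous_compact; first by apply: continuous_subspaceT.
apply: bounded_closed_compact.
  exists 1; split=> // M M1 v gv.
  change (mx_norm v <= M); rewrite mx_normrE; apply: bigmax_le => [|[i j] _ /=]; first lra.
  rewrite ord1 -(vec_mxK v); case/mxvec_indexP: j => k l; rewrite mxvecE.
  by apply: le_trans (ltW M1); exact: G2_entry.
by apply: closed_comp => [v _|]; [exact: cv|exact: closed_G2].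
Qed.

Lemma linear_lie_group_G2 : linear_lie_group (G2 R).
Proof.
split.
- by move=> A [].
- exact: G2_1.
- exact: G2_mulmx.
- exact: G2_inv.
- exists (G2 R); first exact: closed_G2.
  by apply/esym/setIidl => A [].
Qed.

End Compactness.

Section ContinuityAt.
Variables (R : realType) (T : topologicalType) (x : T).

Lemma ctsD (V : normedModType R) (f g : T -> V) :
  {for x, continuous f} -> {for x, continuous g} ->
  {for x, continuous (fun z => f z + g z)}.
Proof. by move=> cf cg; apply: cvgD. Qed.

Lemma ctsB (V : normedModType R) (f g : T -> V) :
  {for x, continuous f} -> {for x, continuous g} ->
  {for x, continuous (fun z => f z - g z)}.
Proof. by move=> cf cg; apply: cvgB. Qed.

Lemma ctsZ (V : normedModType R) (k : T -> R) (g : T -> V) :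
  {for x, continuous k} -> {for x, continuous g} ->
  {for x, continuous (fun z => k z *: g z)}.
Proof. by move=> cf cg; apply: cvgZ. Qed.

Lemma ctsM (f g : T -> R) :
  {for x, continuous f} -> {for x, continuous g} ->
  {for x, continuous (fun z => f z * g z)}.
Proof. by move=> cf cg; apply: cvgM. Qed.

Lemma ctsV (f : T -> R) : f x != 0 ->
  {for x, continuous f} -> {for x, continuous (fun z => (f z)^-1)}.
Proof. by move=> fx cf; apply: cvgV. Qed.

Lemma cts_comp (U W : topologicalType) (f : T -> U) (g : U -> W) :
  {for x, continuous f} -> {for f x, continuous g} ->
  {for x, continuous (fun z => g (f z))}.
Proof. by move=> cf cg; apply: (cvg_comp f g cf). Qed.

Lemma cts_pair (U W : topologicalType) (f : T -> U) (g : T -> W) :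
  {for x, continuous f} -> {for x, continuous g} ->
  {for x, continuous (fun z => (f z, g z))}.
Proof. by move=> cf cg; apply: cvg_pair. Qed.

Lemma cts_min (f g : T -> R) :
  {for x, continuous f} -> {for x, continuous g} ->
  {for x, continuous (fun z => Num.min (f z) (g z))}.
Proof. by move=> cf cg; exact: (continuous_min cf cg). Qed.

Lemma cts_max (f g : T -> R) :
  {for x, continuous f} -> {for x, continuous g} ->
  {for x, continuous (fun z => Num.max (f z) (g z))}.
Proof. by move=> cf cg; exact: (continuous_max cf cg). Qed.

End ContinuityAt.

Lemma cts_fst (T U : topologicalType) (z : T * U) :
  {for z, continuous (fun z : T * U => z.1)}.
Proof. exact: cvg_fst. Qed.

Lemma cts_snd (T U : topologicalType) (z : T * U) :
  {for z, continuous (fun z : T * U => z.2)}.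
Proof. exact: cvg_snd. Qed.

Arguments cts_fst {T U} z.
Arguments cts_snd {T U} z.

(** * Retraction of the line onto the unit interval *)

Section Clamp.
Variable R : realType.

(** Precomposing with this retraction replaces continuity within [0, 1] by plain continuity on the
    line. *)
Definition clamp (t : R) : R := Num.max 0 (Num.min t 1).

Lemma clamp_itv t : 0 <= clamp t <= 1.
Proof. by rewrite /clamp le_max lexx ge_max ler01 ge_min lexx orbT. Qed.

Lemma clamp_id t : 0 <= t <= 1 -> clamp t = t.
Proof.
by move=> /andP[t0 t1]; rewrite /clamp (min_idPl t1) (max_idPr t0).
Qed.

Lemma clamp_le0 t : t <= 0 -> clamp t = 0.
Proof. by move=> t0; apply: max_idPl; rewrite ge_min t0. Qed.

Lemma clamp_ge1 t : 1 <= t -> clamp t = 1.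
Proof. by move=> t1; rewrite /clamp (min_idPr t1) (max_idPr ler01). Qed.

Lemma clamp0 : clamp 0 = 0. Proof. exact: clamp_le0. Qed.
Lemma clamp1 : clamp 1 = 1. Proof. exact: clamp_ge1. Qed.

Lemma clampK t : clamp (clamp t) = clamp t.
Proof. by rewrite clamp_id // clamp_itv. Qed.

Lemma dist_min (s a b : R) : `|Num.min s a - Num.min s b| <= `|a - b|.
Proof.
have := ler_norm (a - b); have := ler_norm (b - a); rewrite (distrC b a) => h1 h2.
rewrite ler_norml; case: (leP s a) => ?; case: (leP s b) => ?;
  by apply/andP; split; lra.
Qed.

Lemma dist_clamp (a b : R) : `|clamp a - clamp b| <= `|a - b|.
Proof.
have h : `|Num.min a 1 - Num.min b 1| <= `|a - b|.
  by rewrite !(minC _ 1); exact: dist_min.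
apply: le_trans h; rewrite /clamp.
move: (Num.min a 1) (Num.min b 1) => x y.
have := ler_norm (x - y); have := ler_norm (y - x); rewrite (distrC y x) => h1 h2.
rewrite ler_norml; case: (leP 0 x) => ?; case: (leP 0 y) => ?;
  by apply/andP; split; lra.
Qed.

Lemma cts_clamp (T : topologicalType) (x : T) (f : T -> R) :
  {for x, continuous f} -> {for x, continuous (fun z => clamp (f z))}.
Proof. by move=> cf; apply: cts_max; [|apply: cts_min => //]; exact: cts_cst. Qed.

End Clamp.

Section UniformContinuity.
Variables (R : realType) (V : normedModType R).

(* Near covering turns local oscillation bounds into a uniform one. *)
Lemma unif_square (A : R * R -> V) (d : R) : 0 < d ->
  (forall z, {for z, continuous A}) ->
  exists N : nat, forall t s s', 0 <= t <= 1 -> 0 <= s <= 1 -> 0 <= s' <= 1 ->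
    `|s - s'| <= N.+1%:R^-1 -> `|A (t, s) - A (t, s')| < d.
Proof.
move=> d0 cA.
have cK : compact ([set t : R | 0 <= t <= 1] `*` [set s : R | 0 <= s <= 1]).
  by apply: compact_setX; rewrite -set_itvcc; exact: segment_compact.
move/compact_near_coveringP: cK => /(_ nat (\oo)
  (fun n z => forall s', `|z.2 - s'| <= n.+1%:R^-1 -> `|A z - A (z.1, s')| < d) _).
case=> [z _|N _ h]; last first.
  by exists N => t s s' ht hs hs'; exact: (h N (leqnn _) (t, s) (conj ht hs)).
have [e e0 he] : exists2 e, 0 < e &
    forall w : R * R, `|z.1 - w.1| < e -> `|z.2 - w.2| < e -> `|A z - A w| < d / 2.
  have /cvgrPdist_lt/(_ (d / 2)) := cA z.
  have d2 : 0 < d / 2 by lra.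
  move=> /(_ d2)/nbhs_ballP[e /= e0 he]; exists e => // w w1 w2.
  by apply: he; split.
have e2 : 0 < e / 2 by lra.
(* Half the radius is spent on the point and half on the displacement, so both values of [A] stay
   within [d / 2] of [A z]. *)
exists (ball z (e / 2), [set n : nat | n.+1%:R^-1 < e / 2]).
  by split; [exact: nbhsx_ballx|exact: near_infty_natSinv_lt (PosNum e2)].
move=> [z' n] /= [[z1 z2] hn] s' hs'.
have h1 : `|A z - A z'| < d / 2.
  have le2 : e / 2 <= e by lra.
  by apply: he; [exact: lt_le_trans z1 le2|exact: lt_le_trans z2 le2].
have h2 : `|A z - A (z'.1, s')| < d / 2.
  have le2 : e / 2 <= e by lra.
  apply: he => /=; first exact: lt_le_trans z1 le2.
  have -> : z.2 - s' = (z.2 - z'.2) + (z'.2 - s') by rewrite addrA subrK.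
  apply: le_lt_trans (ler_normD _ _) _.
  have h3 : `|z.2 - z'.2| < e / 2 by exact: z2.
  by rewrite [ltRHS](splitr e); apply: ltrD h3 _; exact: le_lt_trans hs' hn.
have -> : A z' - A (z'.1, s') = - (A z - A z') + (A z - A (z'.1, s')).
  by rewrite opprB addrA subrK.
apply: le_lt_trans (ler_normD _ _) _; rewrite normrN.
by rewrite [ltRHS](splitr d); exact: ltrD h1 h2.
Qed.

End UniformContinuity.

(** * Lifting of paths and homotopies *)

Section Homotopy.
Variable R : realType.

Section Relations.
Variables (V : normedModType R) (E : set V).

Definition joined (x y : V) := exists f : R -> V,
  [/\ forall t, {for t, continuous f}, forall t, E (f t), f 0 = x & f 1 = y].

(* Homotopies relative to the end points; they are defined and stay in [E] on
   the whole plane, but are only constrained to relate [f] and [g] on [0, 1]. *)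
Definition homot (f g : R -> V) := exists K : R * R -> V,
  [/\ forall z, {for z, continuous K}, forall z, E (K z),
      forall t, 0 <= t <= 1 -> K (t, 0) = f t /\ K (t, 1) = g t &
      forall s, K (0, s) = f 0 /\ K (1, s) = f 1].

(* Adding the increments concatenates without gluing along a closed set. *)
Lemma joined_trans x y z : joined x y -> joined y z -> joined x z.
Proof.
move=> [f [cf Ef f0 f1]] [g [cg Eg g0 g1]].
exists (fun t => f (clamp (2%:R * t)) + g (clamp (2%:R * t - 1)) - y).
split=> [t|t||].
- apply: ctsB; last exact: cts_cst.
  apply: ctsD; apply: cts_comp => //; apply: cts_clamp.
    by apply: ctsM; [exact: cts_cst|exact: cts_id].
  apply: ctsB; last exact: cts_cst.
  by apply: ctsM; [exact: cts_cst|exact: cts_id].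
- have [t2|t2] := leP (2%:R * t) 1.
    by rewrite (@clamp_le0 _ (_ - 1)) ?g0 ?addrK //; lra.
  by rewrite clamp_ge1 ?f1 1?addrAC ?subrr ?add0r //; lra.
- by rewrite mulr0 clamp0 f0 clamp_le0 ?g0 ?addrK //; lra.
- by rewrite mulr1 clamp_ge1 ?clamp_ge1 ?f1 ?g1 1?addrAC ?subrr ?add0r //; lra.
Qed.

(** The second homotopy is added as its increment over its initial stage. At each point two of the
    three terms cancel, which keeps the sum in [E]; the path parameter is clamped because [K] and
    [L] match only over [0, 1]. *)
Lemma homot_trans f g h : homot f g -> homot g h -> homot f h.
Proof.
move=> [K [cK EK Kfg K01]] [L [cL EL Lgh L01]].
exists (fun z => K (clamp z.1, clamp (2%:R * z.2)) +
                 L (clamp z.1, clamp (2%:R * z.2 - 1)) - L (clamp z.1, 0)).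
have g0 : g 0 = f 0.
  by have [|_ <-] := Kfg 0; [rewrite lexx ler01|case: (K01 1)].
have g1 : g 1 = f 1.
  by have [|_ <-] := Kfg 1; [rewrite ler01 lexx|case: (K01 1)].
have KL t : 0 <= t <= 1 -> K (t, 1) = L (t, 0).
  by move=> ht; have [_ ->] := Kfg _ ht; have [->] := Lgh _ ht.
have e1 z : 2%:R * z.2 <= 1 ->
    K (clamp z.1, clamp (2%:R * z.2)) +
    L (clamp z.1, clamp (2%:R * z.2 - 1)) - L (clamp z.1, 0) =
    K (clamp z.1, clamp (2%:R * z.2)).
  by move=> z2; rewrite (@clamp_le0 _ (_ - 1)) ?addrK //; lra.
have e2 z : 1 <= 2%:R * z.2 ->
    K (clamp z.1, clamp (2%:R * z.2)) +
    L (clamp z.1, clamp (2%:R * z.2 - 1)) - L (clamp z.1, 0) =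
    L (clamp z.1, clamp (2%:R * z.2 - 1)).
  move=> z2; rewrite (@clamp_ge1 _ (2%:R * z.2)) // KL ?clamp_itv //.
  by rewrite addrAC subrr add0r.
have cc : forall z : R * R, {for z, continuous (fun z : R * R => clamp z.1)}.
  by move=> z; apply: cts_clamp; exact: cts_fst.
have c2 : forall z : R * R, {for z, continuous (fun z : R * R => 2%:R * z.2)}.
  by move=> z; apply: ctsM; [exact: cts_cst|exact: cts_snd].
split=> [z|z|t ht|s].
- apply: ctsB; [apply: ctsD|].
  + apply: (cts_comp (f := fun z : R * R => (clamp z.1, clamp (2%:R * z.2))) (g := K)) => //.
    by apply: cts_pair => //; apply: cts_clamp.
  + apply: (cts_comp (f := fun z : R * R => (clamp z.1, clamp (2%:R * z.2 - 1))) (g := L)) => //.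
    apply: cts_pair => //; apply: cts_clamp; apply: ctsB => //; exact: cts_cst.
  + apply: (cts_comp (f := fun z : R * R => (clamp z.1, 0)) (g := L)) => //.
    by apply: cts_pair => //; exact: cts_cst.
- have [z2|/ltW z2] := leP (2%:R * z.2) 1; first by rewrite e1.
  by rewrite e2.
- have h0 : 2%:R * (t, 0 : R).2 <= 1 by rewrite mulr0.
  have h1 : 1 <= 2%:R * (t, 1 : R).2 by rewrite mulr1 ler1n.
  rewrite (e1 _ h0) (e2 _ h1) /= mulr0 mulr1 clamp0 clamp_id // clamp_ge1; last lra.
  by have [-> _] := Kfg t ht; have [_ ->] := Lgh t ht.
- have [s2|/ltW s2] := leP (2%:R * s) 1.
    by rewrite !e1 //= clamp0 clamp1; case: (K01 (clamp (2%:R * s))); split.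
  rewrite !e2 //= clamp0 clamp1 -g0 -g1.
  by case: (L01 (clamp (2%:R * s - 1))) => -> ->; split.
Qed.

End Relations.

Lemma sub_homot (V : normedModType R) (E F : set V) f g :
  E `<=` F -> homot E f g -> homot F f g.
Proof. by move=> EF [K [cK EK Kfg K01]]; exists K; split=> // z; exact: EF. Qed.

Lemma sub_joined (V : normedModType R) (E F : set V) x y :
  E `<=` F -> joined E x y -> joined F x y.
Proof. by move=> EF [f [cf Ef f0 f1]]; exists f; split=> // z; exact: EF. Qed.

Section Lifting.
Variables (V W : normedModType R) (E : set V) (S : set W) (pr : V -> W).
(** A lifting function with a uniform radius replaces local trivialisations. Its continuity is asked
    in the ambient spaces, so a lift has to be a formula that makes sense off [E] and [S] as
    well. *)
Variables (lift : V -> W -> V) (d : R).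
Hypothesis d0 : 0 < d.
Hypothesis cpr : forall v, {for v, continuous pr}.
Hypothesis prS : forall v, E v -> S (pr v).
Hypothesis liftP : forall v w, E v -> S w -> `|pr v - w| < d ->
  [/\ E (lift v w), pr (lift v w) = w &
      {for (v, w), continuous (fun z => lift z.1 z.2)}].
Hypothesis lift_id : forall v, E v -> lift v (pr v) = v.

(* Lift stepwise in the homotopy parameter; since lifting is the identity where
   nothing moves, stopping the parameter with [min] avoids gluing. *)
Lemma homotopy_lifting (f : R -> V) (A : R * R -> W) :
  (forall t, {for t, continuous f}) -> (forall t, E (f t)) ->
  (forall z, {for z, continuous A}) -> (forall z, S (A z)) ->
  (forall t s, A (t, s) = A (clamp t, clamp s)) ->
  (forall t, A (t, 0) = pr (f t)) ->
  exists K : R * R -> V, [/\ forall z, {for z, continuous K}, forall z, E (K z),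
    forall t, K (t, 0) = f t, forall t s, pr (K (t, s)) = A (t, s) &
    forall t, (forall s, A (t, s) = A (t, 0)) -> forall s, K (t, s) = f t].
Proof.
move=> cf Ef cA SA Acl A0; have [N unifA] := unif_square d0 cA.
pose c i : R := i%:R / N.+1%:R.
have N0 : 0 < N.+1%:R :> R by rewrite ltr0n.
have cge0 i : 0 <= c i by rewrite divr_ge0 ?ler0n.
suff H i : exists K : R * R -> V, [/\ forall z, {for z, continuous K},
    forall z, E (K z), forall t, K (t, 0) = f t,
    forall t s, pr (K (t, s)) = A (t, Num.min s (c i)) &
    forall t, (forall s, A (t, s) = A (t, 0)) -> forall s, K (t, s) = f t].
  have [K [cK EK K0 prK Kc]] := H N.+1; exists K; split=> // t s.
  rewrite prK [LHS]Acl [RHS]Acl; congr (A (_, _)).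
  rewrite /c divff ?gt_eqF //; case: (leP s 1) => // s1.
  by rewrite clamp1 clamp_ge1 // ltW.
elim: i => [|i [K [cK EK K0 prK Kc]]].
  exists (fun z => f z.1); split=> // [z|t s].
    by apply: cts_comp => //; exact: cts_fst.
  rewrite -A0 Acl [RHS]Acl /c mul0r; congr (A (_, _)).
  by rewrite clamp0 clamp_le0 // ge_min lexx orbT.
(* [K] lies over [A] stopped at [c i], the target is [A] stopped one step of length 1/(N+1) later,
   and stopping and clamping are 1-Lipschitz. *)
have dist t s : `|pr (K (t, s)) - A (t, Num.min s (c i.+1))| < d.
  rewrite prK Acl [X in _ - X]Acl; apply: unifA; rewrite ?clamp_itv //.
  have -> : c i.+1 = c i + N.+1%:R^-1 by rewrite /c -natr1 mulrDl mul1r.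
  have r0 : 0 < N.+1%:R^-1 :> R by rewrite invr_gt0.
  apply: le_trans (dist_clamp _ _) (le_trans (dist_min _ _ _) _).
  by rewrite opprD addNKr normrN ger0_norm // ltW.
exists (fun z => lift (K z) (A (z.1, Num.min z.2 (c i.+1)))); split.
- move=> [t s]; have [|||_ _ cl] := @liftP (K (t, s)) (A (t, Num.min s (c i.+1))) => //.
  apply: (@cts_comp _ _ _ _ (fun z => (K z, A (z.1, Num.min z.2 (c i.+1))))
    (fun z => lift z.1 z.2)) => //.
  apply: cts_pair => //; apply: (cts_comp (f := fun z : R * R => (z.1, Num.min z.2 (c i.+1))) (g := A)) => //.
  apply: cts_pair; first exact: cts_fst.
  by apply: cts_min; [exact: cts_snd|exact: cts_cst].
- by move=> [t s]; have [] := @liftP (K (t, s)) (A (t, Num.min s (c i.+1))).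
- by move=> t /=; rewrite (min_idPl (cge0 _)) K0 A0 lift_id.
- by move=> t s; have [] := @liftP (K (t, s)) (A (t, Num.min s (c i.+1))).
- by move=> t At s /=; rewrite Kc // At A0 lift_id.
Qed.

Variable w0 : W.
Let F := [set v | E v /\ pr v = w0].

(** A lifted base path carries [v] into the fibre over [w0], where the hypothesis on the fibre takes
    over. *)
Lemma joined_fibration v0 :
  (forall w, S w -> joined S w w0) -> (forall v, F v -> joined F v v0) ->
  forall v, E v -> joined E v v0.
Proof.
move=> jS jF v Ev; have [g [cg Sg g0 g1]] := jS _ (prS Ev).
(* Path lifting is homotopy lifting for a constant initial map, the homotopy parameter serving as
   time. *)
have [|||||t|K [cK EK K0 prK _]] := @homotopy_lifting (fun=> v) (fun z => g (clamp z.2)).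
- by move=> t; exact: cts_cst.
- by [].
- by move=> z; apply: cts_comp => //; apply: cts_clamp; exact: cts_snd.
- by [].
- by move=> t s /=; rewrite clampK.
- by rewrite /= clamp0 g0.
apply: (@joined_trans _ _ _ (K (0, 1))).
  exists (fun s => K (0, s)); split=> // t.
  apply: (cts_comp (f := fun s : R => (0, s)) (g := K)) => //.
  by apply: cts_pair; [exact: cts_cst|exact: cts_id].
apply: (@sub_joined _ F) => [? []//|]; apply: jF; split=> //.
by rewrite prK /= clamp1 g1.
Qed.

(** This is exactness of the fundamental groups of fibre, total space and base at the middle term:
    lifting a contraction of the projected loop ends with a loop in the fibre. The end points stay
    put because the lift is constant wherever the base homotopy is. *)
Lemma homot_fibration v0 : F v0 ->
  (forall g : R -> W, (forall t, {for t, continuous g}) -> (forall t, S (g t)) ->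
     g 0 = w0 -> g 1 = w0 -> homot S g (fun=> w0)) ->
  (forall f : R -> V, (forall t, {for t, continuous f}) -> (forall t, F (f t)) ->
     f 0 = v0 -> f 1 = v0 -> homot F f (fun=> v0)) ->
  forall f : R -> V, (forall t, {for t, continuous f}) -> (forall t, E (f t)) ->
     f 0 = v0 -> f 1 = v0 -> homot E f (fun=> v0).
Proof.
move=> [Ev0 pv0] hS hF f cf Ef f0 f1.
have [||||G [cG SG Gfg G01]] := hS (fun t => pr (f t)).
- by move=> t; apply: cts_comp.
- by move=> t; exact: prS.
- by rewrite f0.
- by rewrite f1.
have [|||||t|K [cK EK K0 prK Kc]] := @homotopy_lifting (fun t => f (clamp t))
  (fun z => G (clamp z.1, clamp z.2)).
- by move=> t; apply: cts_comp => //; apply: cts_clamp; exact: cts_id.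
- by [].
- move=> z; apply: (cts_comp (f := fun z : R * R => (clamp z.1, clamp z.2)) (g := G)) => //.
  by apply: cts_pair; apply: cts_clamp; [exact: cts_fst|exact: cts_snd].
- by [].
- by move=> t s /=; rewrite !clampK.
- by rewrite /= clamp0; have [] := Gfg (clamp t) (clamp_itv t).
have K0s s : K (0, s) = v0.
  rewrite Kc ?clamp0 // => u /=; rewrite clamp0.
  by have [-> _] := G01 (clamp u); have [-> _] := G01 0.
have K1s s : K (1, s) = v0.
  rewrite Kc ?clamp1 // => u /=; rewrite clamp1.
  by have [_ ->] := G01 (clamp u); have [_ ->] := G01 (clamp 0).
apply: (@homot_trans _ _ _ (fun t => K (t, 1))).
  exists K; split=> // [t ht|s]; first by rewrite K0 clamp_id.
  by rewrite K0s K1s f0 f1.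
apply: (@sub_homot _ F) => [? []//|]; apply: hF => [t|t||].
- apply: (cts_comp (f := fun t : R => (t, 1 : R)) (g := K)) => //.
  by apply: cts_pair; [exact: cts_id|exact: cts_cst].
- split=> //; rewrite prK /= clamp1.
  by have [_ ->] := Gfg (clamp t) (clamp_itv t).
- exact: K0s.
- exact: K1s.
Qed.

End Lifting.
End Homotopy.

(** * Loops on spheres *)

Section Spheres.
Variable R : realType.
Implicit Types (x y p v : 'cV[R]_8).

(** For [k] equal to 1, 2 and 4 these are S^6, S^5 and S^3, cut out by orthogonality to 1, then also
    to e_1, then to all quaternions. *)
Definition sphere (k : nat) : set 'cV[R]_8 :=
  [set x | dot x x = 1 /\ forall i, (i < k)%N -> ocoord x i = 0].

Definition normalize v := (Num.sqrt (dot v v))^-1 *: v.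

Lemma dot_normalize v : v != 0 -> dot (normalize v) (normalize v) = 1.
Proof.
move=> v0; have vv : 0 < dot v v.
  by rewrite lt0r dot_ge0 andbT; apply: contraNN v0 => /eqP/dot_eq0 ->.
by rewrite dotZl dotZr mulrA -invfM -expr2 sqr_sqrtr ?mulVf ?gt_eqF // ltW.
Qed.

Lemma normalize_id v : dot v v = 1 -> normalize v = v.
Proof. by move=> vv; rewrite /normalize vv sqrtr1 invr1 scale1r. Qed.

Lemma sphere_normalize k v : v != 0 -> (forall i, (i < k)%N -> ocoord v i = 0) -> sphere k (normalize v).
Proof.
by move=> v0 vk; split=> [|i ik]; rewrite ?dot_normalize // ocoordZ vk // mulr0.
Qed.

Lemma cts_normalize (T : topologicalType) (x : T) (f : T -> 'cV[R]_8) : f x != 0 ->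
  {for x, continuous f} -> {for x, continuous (fun z => normalize (f z))}.
Proof.
move=> fx cf; apply: ctsZ => //; apply: ctsV.
  rewrite sqrtr_eq0 -ltNge lt0r dot_ge0 andbT.
  by apply: contraNN fx => /eqP/dot_eq0 ->.
apply: (cts_comp (f := fun z => dot (f z) (f z))); first exact: cts_dot.
exact: sqrt_continuous.
Qed.

Lemma dot_eq1 x y : dot x x = 1 -> dot y y = 1 -> dot x y = 1 -> x = y.
Proof.
move=> xx yy xy; apply: subr0_eq; apply: dot_eq0.
by rewrite !(dotDl, dotDr) !(dotNl, dotNr) (dotC y x) xx yy xy; ring.
Qed.

Lemma entry_le1 x i : dot x x = 1 -> `|x i 0| <= 1.
Proof.
rewrite /dot (bigD1 i) //= => e.
have s0 : 0 <= \sum_(k | k != i) x k 0 * x k 0.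
  by apply: sumr_ge0 => k _; rewrite -expr2 sqr_ge0.
by rewrite ler_norml; apply/andP; split; nra.
Qed.

(** The norm is the maximum of the entries, and entries of a unit vector are at most 1, so the eight
    terms give the factor 8. *)
Lemma dot_le u x (e : R) : `|u| <= e -> dot x x = 1 -> `|dot u x| <= 8%:R * e.
Proof.
move=> ue xx; apply: le_trans (ler_norm_sum _ _ _) _.
apply: le_trans (_ : \sum_(i < 8) e <= _); last first.
  by rewrite sumr_const card_ord mulr_natl.
apply: ler_sum => i _; rewrite normrM -[leRHS]mulr1.
apply: ler_pM => //; last exact: entry_le1.
apply: le_trans ue; rewrite [leRHS]mx_normrE.
by apply: (le_trans _ (le_bigmax _ _ (i, 0))).
Qed.

Section Stereographic.
Variable p : 'cV[R]_8.
Hypothesis pp : dot p p = 1.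

Definition stereo x := (1 - dot x p)^-1 *: (x - dot x p *: p).
Definition unstereo y := (dot y y + 1)^-1 *: (2%:R *: y + (dot y y - 1) *: p).

Lemma dot_stereo x : dot (stereo x) p = 0.
Proof. by rewrite dotZl dotDl dotNl dotZl pp mulr1 subrr mulr0. Qed.

Lemma dot_unstereo y : dot y p = 0 -> dot (unstereo y) (unstereo y) = 1.
Proof.
move=> yp; have y0 := dot_ge0 y.
rewrite dotZl dotZr !(dotDl, dotDr) !(dotZl, dotZr) (dotC p y) yp pp.
by field; rewrite gt_eqF //; lra.
Qed.

Lemma stereoK x : dot x x = 1 -> x <> p -> unstereo (stereo x) = x.
Proof.
move=> xx xp; have d1 : 1 - dot x p != 0.
  by apply/eqP => h; apply: xp; apply: dot_eq1 => //; lra.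
have e : dot (stereo x) (stereo x) = (1 + dot x p) / (1 - dot x p).
  rewrite dotZl dotZr !(dotDl, dotDr) !(dotNl, dotNr) !(dotZl, dotZr) (dotC p x).
  by rewrite xx pp; field.
rewrite /unstereo e /stereo; apply/colP => i; rewrite !mxE.
field; apply/andP; split => //.
by rewrite [X in X != 0](_ : _ = 2%:R) ?pnatr_eq0 //; ring.
Qed.

Lemma ocoord_unstereo k y : (forall i, (i < k)%N -> ocoord p i = 0 /\ ocoord y i = 0) ->
  forall i, (i < k)%N -> ocoord (unstereo y) i = 0.
Proof.
by move=> h i ik; have [p0 y0] := h i ik; rewrite ocoordZ ocoordD !ocoordZ p0 y0 !mulr0 addr0 mulr0.
Qed.

Lemma cts_unstereo (T : topologicalType) (x : T) (f : T -> 'cV[R]_8) :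
  {for x, continuous f} -> {for x, continuous (fun z => unstereo (f z))}.
Proof.
move=> cf; have cd : {for x, continuous (fun z => dot (f z) (f z))} by exact: cts_dot.
apply: ctsZ.
  apply: ctsV; last exact: (ctsD (V := R^o) cd (cts_cst x (1 : R))).
  by rewrite gt_eqF // ltr_wpDl ?dot_ge0.
apply: ctsD; first exact: (ctsZ (cts_cst x (2%:R : R)) cf).
exact: (ctsZ (ctsB (V := R^o) cd (cts_cst x (1 : R))) (cts_cst x p)).
Qed.

Lemma cts_stereo (T : topologicalType) (x : T) (f : T -> 'cV[R]_8) :
  dot (f x) (f x) = 1 -> f x <> p ->
  {for x, continuous f} -> {for x, continuous (fun z => stereo (f z))}.
Proof.
move=> fx fp cf; have cd : {for x, continuous (fun z => dot (f z) p)}.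
  exact: (cts_dot cf (cts_cst x p)).
apply: ctsZ.
  apply: ctsV; last exact: (ctsB (V := R^o) (cts_cst x (1 : R)) cd).
  by apply/eqP => h; apply: fp; apply: dot_eq1 => //; lra.
exact: (ctsB cf (ctsZ cd (cts_cst x p))).
Qed.

(** A straight segment in the stereographic chart, hence a path on the sphere; equal end points give
    a constant path, which keeps homotopies relative to the base point. *)
Definition chart_segment x y (s : R) :=
  unstereo ((1 - s) *: stereo x + s *: stereo y).

Lemma chart_segment_sphere k x y s : sphere k p -> sphere k x -> sphere k y ->
  sphere k (chart_segment x y s).
Proof.
move=> [_ pk] [_ xk] [_ yk]; split.
  by rewrite dot_unstereo // dotDl (dotZl (1 - s)) (dotZl s) !dot_stereo !mulr0 addr0.
apply: ocoord_unstereo => i ik; split; first exact: pk.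
by rewrite ocoordD !ocoordZ !ocoordD !ocoordN !ocoordZ pk // xk // yk //; ring.
Qed.

Lemma chart_segment0 x y : dot x x = 1 -> x <> p -> chart_segment x y 0 = x.
Proof.
by move=> xx xp; rewrite /chart_segment subr0 scale1r scale0r addr0 stereoK.
Qed.

Lemma chart_segment1 x y : dot y y = 1 -> y <> p -> chart_segment x y 1 = y.
Proof.
by move=> yy yp; rewrite /chart_segment subrr scale0r scale1r add0r stereoK.
Qed.

Lemma chart_segment_same x s : dot x x = 1 -> x <> p -> chart_segment x x s = x.
Proof.
by move=> xx xp; rewrite /chart_segment -scalerDl subrK scale1r stereoK.
Qed.

Lemma cts_chart_segment (T : topologicalType) (z0 : T) (f g : T -> 'cV[R]_8)
    (s : T -> R) :
  dot (f z0) (f z0) = 1 -> f z0 <> p -> dot (g z0) (g z0) = 1 -> g z0 <> p ->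
  {for z0, continuous f} -> {for z0, continuous g} -> {for z0, continuous s} ->
  {for z0, continuous (fun z => chart_segment (f z) (g z) (s z))}.
Proof.
move=> ff fp gg gp cf cg cs; apply: cts_unstereo; apply: ctsD; apply: ctsZ.
- exact: (ctsB (V := R^o) (cts_cst z0 (1 : R)) cs).
- exact: (cts_stereo ff fp cf).
- exact: cs.
- exact: (cts_stereo gg gp cg).
Qed.

End Stereographic.

Lemma joined_sphere k p x y : sphere k p -> sphere k x -> sphere k y -> x <> p -> y <> p ->
  joined (sphere k) x y.
Proof.
move=> pk xk yk xp yp; have [[pp _] [xx _] [yy _]] := And3 pk xk yk.
exists (chart_segment p x y); split.
- move=> t.
  exact: (cts_chart_segment pp xx xp yy yp (cts_cst _ _) (cts_cst _ _) (cts_id _)).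
- by move=> t; exact: chart_segment_sphere.
- exact: chart_segment0.
- exact: chart_segment1.
Qed.

Lemma homot_sphere_missing k p (f : R -> 'cV[R]_8) x : sphere k p ->
  (forall t, {for t, continuous f}) -> (forall t, sphere k (f t)) ->
  (forall t, f t <> p) -> f 0 = x -> f 1 = x -> homot (sphere k) f (fun=> x).
Proof.
move=> pk cf Sf fp f0 f1; have [pp _] := pk.
exists (fun z => chart_segment p (f z.1) x z.2); split.
- move=> z; have [ff _] := Sf z.1; have [xx _] := Sf 0.
  have xp : x <> p by rewrite -f0.
  apply: (@cts_chart_segment p pp _ z (fun z => f z.1) (fun=> x) (fun z => z.2)) => //.
  + by rewrite -f0.
  + exact: (cts_comp (cts_fst z) (cf z.1)).
  + exact: cts_cst.
  + exact: cts_snd.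
- by move=> z; apply: chart_segment_sphere => //; rewrite -f0.
- move=> t _ /=; have [ff _] := Sf t; have [xx _] := Sf 0.
  by rewrite chart_segment0 // -f0 chart_segment1.
- move=> s /=; have [xx _] := Sf 0.
  by rewrite f0 f1 -f0 chart_segment_same.
Qed.

End Spheres.

(** * A pole off finitely many planes *)

Section GenericPoint.
Variable R : realType.
Implicit Types (x y u v : 'cV[R]_8).

(* The vectors (1, m, m^2) meet every plane through the origin finitely often. *)
Definition moment (m : R) : 'cV[R]_8 := oct 0 0 0 0 0 1 m (m ^+ 2).

(** Only the coordinates 5, 6, 7 are read: they are free on every sphere with [k <= 5], and three
    dimensions are the least in which two vectors never span everything. *)
Definition functional (n : R * R * R) x :=
  n.1.1 * ocoord x 5 + n.1.2 * ocoord x 6 + n.2 * ocoord x 7.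

Lemma functionalD n x y : functional n (x + y) = functional n x + functional n y.
Proof. by rewrite /functional !ocoordD; ring. Qed.

Lemma functionalZ n a x : functional n (a *: x) = a * functional n x.
Proof. by rewrite /functional !ocoordZ; ring. Qed.

(** Two linear conditions on three coefficients: a 3 by 2 matrix has a nonzero left kernel. *)
Lemma functional_exists u v :
  exists2 n, n <> (0, 0, 0) & functional n u = 0 /\ functional n v = 0.
Proof.
pose M : 'M[R]_(3, 2) := \matrix_(i, j) if j == 0 then ocoord u (5 + i) else ocoord v (5 + i).
have : kermx M != 0.
  rewrite -mxrank_eq0 mxrank_ker -lt0n subn_gt0.
  exact: leq_ltn_trans (rank_leq_col M) _.
case/rowV0Pn => w /sub_kermxP wM w0.
exists (w 0 0, w 0 1, w 0 2%:R) => [[w00 w01 w02]|].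
  move/negP: w0; apply; apply/eqP/rowP => i; rewrite mxE.
  case: i => [] [|[|[|//]]] hi.
  - by rewrite -[RHS]w00; congr (w _ _); apply/val_inj.
  - by rewrite -[RHS]w01; congr (w _ _); apply/val_inj.
  - by rewrite -[RHS]w02; congr (w _ _); apply/val_inj.
have h j : (w *m M) 0 j = 0 by rewrite wM mxE.
split; rewrite /functional /=.
  by have := h 0; rewrite mxE !big_ord_recr big_ord0 !mxE /= add0r => <-;
  congr (w _ _ * _ + w _ _ * _ + w _ _ * _); apply/val_inj.
by have := h 1; rewrite mxE !big_ord_recr big_ord0 !mxE /= add0r => <-;
  congr (w _ _ * _ + w _ _ * _ + w _ _ * _); apply/val_inj.
Qed.

Lemma poly_nonroot (q : {poly R}) : q != 0 -> exists m, q.[m] != 0.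
Proof.
move=> q0; have [[m hm]|h] := pselect (exists m, q.[m] != 0); first by exists m.
pose rs : seq R := [seq i%:R | i <- iota 0 (size q)].
have : (size rs < size q)%N.
  apply: max_poly_roots => //.
    by apply/allP => z _; apply/negPn/negP => hz; apply: h; exists z.
  by rewrite map_inj_uniq ?iota_uniq // => i j /eqP; rewrite eqr_nat => /eqP.
by rewrite size_map size_iota ltnn.
Qed.

(** Along the moment curve each form becomes a nonzero polynomial of degree at most 2; a non-root of
    the product of these polynomials serves all forms at once. *)
Lemma moment_generic (ns : seq (R * R * R)) :
  {in ns, forall n, n <> (0, 0, 0)} ->
  exists m, {in ns, forall n, functional n (moment m) != 0}.
Proof.
move=> ns0.
pose q (n : R * R * R) : {poly R} := n.1.1%:P + n.1.2 *: 'X + n.2 *: 'X^2.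
have qE n m : functional n (moment m) = (q n).[m].
  by rewrite /functional /moment !ocoord_oct !hornerE /=; ring.
have [|m hm] := @poly_nonroot (\prod_(n <- ns) q n).
  rewrite prodf_seq_neq0; apply/allP => n nns /=; apply/eqP => qn0.
  apply: (ns0 _ nns).
  have c i : (q n)`_i = 0 by rewrite qn0 coef0.
  have := (c 0%N, c 1%N, c 2%N).
  rewrite /q !coefD !coefZ !coefC !coefX !coefXn /= !(mulr0, mulr1, addr0, add0r).
  by case: n {nns qn0 c} => [[n1 n2] n3] /= [[-> ->] ->].
exists m => n nns; rewrite qE; apply: contraNN hm => /eqP h.
by rewrite horner_prod prodf_seq_eq0; apply/hasP; exists n; rewrite //= h.
Qed.

Lemma moment_neq0 m : moment m != 0.
Proof.
apply/eqP => /(congr1 (fun v => ocoord v 5)); rewrite /moment !ocoord_oct ocoord0 => /eqP.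
by rewrite oner_eq0.
Qed.

Lemma moment_sphere k m : (k <= 5)%N -> sphere k (normalize (moment m)).
Proof.
move=> k5; apply: sphere_normalize (moment_neq0 m) _ => i ik.
have : (i < 5)%N by apply: leq_trans ik k5.
by case: i {ik} => [|[|[|[|[|]]]]] // _; rewrite /moment ocoord_oct.
Qed.

Lemma functional_normalize_neq n m x : functional n (moment m) != 0 ->
  functional n x = 0 -> x <> normalize (moment m).
Proof.
move=> nm nx e; move: nx; rewrite e functionalZ => /eqP; rewrite mulf_eq0 invr_eq0.
rewrite (negbTE nm) orbF sqrtr_eq0 => h.
have /dot_eq0/eqP : dot (moment m) (moment m) = 0.
  by apply/eqP; rewrite eq_le h dot_ge0.
by apply/negP/moment_neq0.
Qed.

Lemma sphere_joined k x y : (k <= 5)%N -> sphere k x -> sphere k y ->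
  joined (sphere k) x y.
Proof.
move=> k5 xk yk; have [n n0 [nx ny]] := functional_exists x y.
have [z|m /(_ n)] := @moment_generic [:: n]; first by rewrite inE => /eqP ->.
rewrite inE eqxx => /(_ isT) nm.
by apply: (joined_sphere (moment_sphere m k5)) => //; apply: functional_normalize_neq nm _.
Qed.

End GenericPoint.

(** * Polygonal approximation and contraction of loops on spheres *)

Section PiecewiseLinear.
Variable R : realType.

Lemma subdivision (N : nat) (x : R) : 0 <= x <= N.+1%:R ->
  exists2 j, (j <= N)%N & j%:R <= x <= j.+1%:R.
Proof.
elim: N => [|N IH] /andP[x0 xN]; first by exists 0%N; rewrite ?x0.
have [xN1|xN1] := leP x N.+1%:R.
  by have [|j jN hj] := IH; [rewrite x0|exists j => //; exact: leqW].
by exists N.+1; rewrite // ltW.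
Qed.

(** Interpolation at the nodes i/(N+1), written as a sum of clamped increments so that continuity
    needs no case distinction. *)
Definition pl_interp (V : lmodType R) (N : nat) (f : R -> V) (t : R) : V :=
  f 0 + \sum_(0 <= i < N.+1) clamp (N.+1%:R * clamp t - i%:R) *:
    (f (i.+1%:R / N.+1%:R) - f (i%:R / N.+1%:R)).

(** On the j-th piece the earlier increments are complete and telescope, while the later ones have
    not started. *)
Lemma pl_interpE (V : lmodType R) (N : nat) (f : R -> V) t :
  exists2 j, (j <= N)%N & exists2 s, 0 <= s <= 1 &
    j%:R <= N.+1%:R * clamp t <= j.+1%:R /\
    pl_interp N f t = (1 - s) *: f (j%:R / N.+1%:R) + s *: f (j.+1%:R / N.+1%:R).
Proof.
have /andP[t0 t1] := clamp_itv t.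
have N0 : 0 < N.+1%:R :> R by rewrite ltr0n.
have [|j jN hj] := @subdivision N (N.+1%:R * clamp t).
  by rewrite mulr_ge0 ?ler0n //= -[leRHS]mulr1 ler_wpM2l ?ler0n.
have /andP[j0 j1] := hj.
exists j => //; exists (N.+1%:R * clamp t - j%:R).
  by rewrite subr_ge0 j0 lerBlDr addrC natr1.
split=> //; rewrite /pl_interp (@big_cat_nat _ _ _ j) //=; last exact: leqW.
rewrite [X in _ + (_ + X)]big_ltn ?ltnS // [X in _ + (_ + (_ + X))]big1_seq => [|i]; last first.
  move=> /andP[_]; rewrite mem_index_iota => /andP[ji _].
  rewrite clamp_le0 ?scale0r //.
  by rewrite subr_le0; apply: le_trans j1 _; rewrite ler_nat.
have -> : \sum_(0 <= i < j) clamp (N.+1%:R * clamp t - i%:R) *: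
    (f (i.+1%:R / N.+1%:R) - f (i%:R / N.+1%:R)) = f (j%:R / N.+1%:R) - f 0.
  have := telescope_sumr (fun i : nat => f (i%:R / N.+1%:R)) (leq0n j).
  rewrite /= mul0r => <-.
  apply: eq_big_nat => i /andP[_ ij]; rewrite clamp_ge1 ?scale1r //.
  rewrite lerBrDr addrC natr1; apply: le_trans j0; by rewrite ler_nat.
rewrite clamp_id; last by rewrite subr_ge0 j0 lerBlDr addrC natr1.
rewrite addr0 addrA [f 0 + _]addrC subrK.
move: (N.+1%:R * _ - _) => s.
by rewrite scalerBl scale1r scalerBr addrA addrAC.
Qed.

Lemma pl_interp0 (V : lmodType R) (N : nat) (f : R -> V) : pl_interp N f 0 = f 0.
Proof.
rewrite /pl_interp big1 ?addr0 // => i _; rewrite clamp0 mulr0 clamp_le0 ?scale0r //.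
Qed.

Lemma pl_interp1 (V : lmodType R) (N : nat) (f : R -> V) : pl_interp N f 1 = f 1.
Proof.
have N0 : N.+1%:R != 0 :> R by rewrite pnatr_eq0.
rewrite /pl_interp clamp1 mulr1 (eq_big_nat _ _ (F2 := fun i =>
  f (i.+1%:R / N.+1%:R) - f (i%:R / N.+1%:R))) => [|i /andP[_ iN]].
  have := telescope_sumr (fun i : nat => f (i%:R / N.+1%:R)) (leq0n N.+1).
  by rewrite /= mul0r divff // => ->; rewrite addrC subrK.
by rewrite clamp_ge1 ?scale1r // lerBrDr addrC natr1 ler_nat.
Qed.

Lemma cts_pl_interp (V : normedModType R) (N : nat) (f : R -> V) t :
  {for t, continuous (pl_interp N f)}.
Proof.
apply: ctsD; first exact: cts_cst.
have -> : (fun t => \sum_(0 <= i < N.+1) clamp (N.+1%:R * clamp t - i%:R) *: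
    (f (i.+1%:R / N.+1%:R) - f (i%:R / N.+1%:R))) =
  (fun t => \sum_(i < N.+1) clamp (N.+1%:R * clamp t - i%:R) *:
    (f (i.+1%:R / N.+1%:R) - f (i%:R / N.+1%:R))).
  by apply/funext => z; rewrite big_mkord.
apply: (@cts_finsum _ _ t _ _ (fun (i : 'I_N.+1) t => clamp (N.+1%:R * clamp t - i%:R) *:
    (f (i.+1%:R / N.+1%:R) - f (i%:R / N.+1%:R)))) => i.
apply: ctsZ; last exact: cts_cst.
apply: cts_clamp; apply: ctsB; last exact: cts_cst.
by apply: ctsM; [exact: cts_cst|apply: cts_clamp; exact: cts_id].
Qed.

Lemma homot_sphere k (f : R -> 'cV[R]_8) x : (k <= 5)%N ->
  (forall t, {for t, continuous f}) -> (forall t, sphere k (f t)) ->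
  f 0 = x -> f 1 = x -> homot (sphere k) f (fun=> x).
Proof.
move=> k5 cf Sf f0 f1.
(* Closeness 1/32 bounds the change of an inner product with a unit vector by 8/32 = 1/4, so the
   segment from the loop to its polygon avoids the origin and can be normalised. *)
have d0 : 0 < 32%:R^-1 :> R by rewrite invr_gt0.
have cf2 (z : R * R) : {for z, continuous (fun z : R * R => f (clamp z.2))}.
  by apply: cts_comp => //; apply: cts_clamp; exact: cts_snd.
have [N hN] := unif_square d0 cf2.
have N0 : 0 < N.+1%:R :> R by rewrite ltr0n.
pose g := pl_interp N f.
have cg t : {for t, continuous g} by exact: cts_pl_interp.
(* A form vanishing at two consecutive nodes vanishes on the whole piece between them, also after
   normalisation. *)
have nodes j : exists2 n : R * R * R, n <> (0, 0, 0) &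
    functional n (f (j%:R / N.+1%:R)) = 0 /\ functional n (f (j.+1%:R / N.+1%:R)) = 0.
  exact: functional_exists.
pose n j := projT1 (cid2 (nodes j)).
have n0 j : n j <> (0, 0, 0) by rewrite /n; case: cid2.
have nf j : functional (n j) (f (j%:R / N.+1%:R)) = 0 /\
    functional (n j) (f (j.+1%:R / N.+1%:R)) = 0 by rewrite /n; case: cid2.
have [|m hm] := @moment_generic R [seq n j | j <- iota 0 N.+1].
  by move=> _ /mapP[j _ ->]; exact: n0.
have ng t : exists2 v, functional v (moment m) != 0 & functional v (g t) = 0.
  have [j jN [s _ [_ gE]]] := pl_interpE N f t.
  exists (n j); first by apply: hm; apply: map_f; rewrite mem_iota.
  by rewrite /g gE functionalD !functionalZ; have [-> ->] := nf j; rewrite !mulr0 addr0.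
have close t : `|g t - f (clamp t)| <= 32%:R^-1.
  have [j jN [s /andP[s0 s1] [/andP[tj tj1] gE]]] := pl_interpE N f t.
  have /andP[t0 t1] := clamp_itv t.
  have tN : clamp t = N.+1%:R * clamp t / N.+1%:R by field; rewrite gt_eqF.
  (* Both nodes of the piece containing [clamp t] lie within 1/(N+1) of it. *)
  have near i : (i <= N.+1)%N -> i%:R - 1 <= N.+1%:R * clamp t <= i%:R + 1 ->
      `|f (i%:R / N.+1%:R) - f (clamp t)| <= 32%:R^-1.
    move=> iN /andP[ti ti1]; apply: ltW.
    have i0 : 0 <= i%:R / N.+1%:R :> R by apply: divr_ge0.
    have i1 : i%:R / N.+1%:R <= 1 :> R by rewrite ler_pdivrMr // mul1r ler_nat.
    have iI := introT andP (conj i0 i1).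
    have := hN 0 (i%:R / N.+1%:R) (clamp t); rewrite /= clampK (clamp_id iI).
    apply; rewrite ?lexx ?ler01 ?t0 //.
    rewrite [X in _ - X]tN -mulrBl normrM (gtr0_norm (_ : 0 < N.+1%:R^-1)) ?invr_gt0 //.
    rewrite -[leRHS]mul1r ler_wpM2r ?invr_ge0 ?ler0n // ler_norml.
    by apply/andP; split; lra.
  have -> : g t - f (clamp t) = (1 - s) *: (f (j%:R / N.+1%:R) - f (clamp t)) +
      s *: (f (j.+1%:R / N.+1%:R) - f (clamp t)).
    by rewrite /g gE !scalerBr addrACA -opprD -scalerDl subrK scale1r.
  have h1 : `|f (j%:R / N.+1%:R) - f (clamp t)| <= 32%:R^-1.
    by apply: near; [exact: leqW|rewrite natr1 tj1 andbT; lra].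
  have h2 : `|f (j.+1%:R / N.+1%:R) - f (clamp t)| <= 32%:R^-1.
    by apply: near => //; move: tj1; rewrite -natr1 => tj1; apply/andP; split; lra.
  apply: le_trans (ler_normD _ _) _; rewrite !normrZ !ger0_norm ?subr_ge0 //.
  have r0 : 0 <= 1 - s by rewrite subr_ge0.
  apply: le_trans (lerD (ler_wpM2l r0 h1) (ler_wpM2l s0 h2)) _.
  by rewrite -mulrDl subrK mul1r.
have dotp t s : 0 <= s <= 1 ->
    0 < dot ((1 - s) *: f (clamp t) + s *: g t) (f (clamp t)).
  move=> /andP[s0 s1]; have [ff _] := Sf (clamp t).
  have -> : (1 - s) *: f (clamp t) + s *: g t = f (clamp t) + s *: (g t - f (clamp t)).
    by rewrite scalerBl scale1r scalerBr addrA addrAC.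
  rewrite dotDl dotZl ff.
  have := dot_le (close t) ff; rewrite ler_norml => /andP[h _].
  have : s * dot (g t - f (clamp t)) (f (clamp t)) >= s * - (8%:R * 32%:R^-1).
    exact: ler_wpM2l.
  have : s * (8%:R * 32%:R^-1) <= 1 * (8%:R * 32%:R^-1) by apply: ler_wpM2r; lra.
  by rewrite mulrN; lra.
have neq0 t s : 0 <= s <= 1 -> (1 - s) *: f (clamp t) + s *: g t != 0.
  by move=> hs; apply: contraTneq (dotp t s hs) => ->; rewrite dot0l ltxx.
have gk t i : (i < k)%N -> ocoord (g t) i = 0.
  move=> ik; have [j jN [s _ [_ gE]]] := pl_interpE N f t.
  have [_ c1] := Sf (j%:R / N.+1%:R); have [_ c2] := Sf (j.+1%:R / N.+1%:R).
  by rewrite /g gE ocoordD !ocoordZ c1 // c2 // !mulr0 addr0.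
have gneq0 t : g t != 0.
  have := neq0 t 1; rewrite subrr scale0r scale1r add0r; apply.
  by rewrite ler01 lexx.
have I0 : 0 <= (0 : R) <= 1 by rewrite lexx ler01.
have I1 : 0 <= (1 : R) <= 1 by rewrite lexx ler01.
have [x1 _] := Sf 0; rewrite f0 in x1.
have g0 : g 0 = x by rewrite /g pl_interp0.
have g1 : g 1 = x by rewrite /g pl_interp1.
apply: (@homot_trans _ _ _ _ (fun t => normalize (g t))); last first.
  apply: (homot_sphere_missing (moment_sphere m k5)).
  - by move=> t; apply: cts_normalize; [exact: gneq0|exact: cg].
  - by move=> t; apply: sphere_normalize; [exact: gneq0|exact: gk].
  - move=> t; have [v vm vg] := ng t; apply: (functional_normalize_neq vm).
    by rewrite functionalZ vg mulr0.
  - by rewrite g0 normalize_id.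
  - by rewrite g1 normalize_id.
exists (fun z => normalize ((1 - clamp z.2) *: f (clamp z.1) + clamp z.2 *: g z.1)).
have c2 (z : R * R) : {for z, continuous (fun z : R * R => clamp z.2)}.
  by apply: cts_clamp; exact: cts_snd.
split.
- move=> z; apply: cts_normalize; first by apply: neq0; exact: clamp_itv.
  apply: ctsD; apply: ctsZ.
  + exact: (ctsB (V := R^o) (cts_cst z (1 : R)) (c2 z)).
  + by apply: (cts_comp _ (cf _)); apply: cts_clamp; exact: cts_fst.
  + exact: c2.
  + exact: (cts_comp (cts_fst z) (cg z.1)).
- move=> z; apply: sphere_normalize; first by apply: neq0; exact: clamp_itv.
  have [_ c1] := Sf (clamp z.1).
  by move=> i ik; rewrite ocoordD !ocoordZ c1 // gk // !mulr0 addr0.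
- move=> t ht /=; have [ff _] := Sf t.
  rewrite clamp0 clamp1 clamp_id // subr0 subrr !scale1r !scale0r addr0 add0r.
  by rewrite normalize_id.
- move=> s /=; rewrite clamp0 clamp1 f0 f1 g0 g1 -scalerDl subrK scale1r.
  by rewrite normalize_id.
Qed.

End PiecewiseLinear.

(** * Simple connectedness *)

Section GramSchmidt.
Variable R : realType.
Implicit Types (a b c x y : 'cV[R]_8) (A g : 'M[R]_8).

Definition gs_b a b := normalize (b - dot b a *: a).
(** The third vector is also made orthogonal to the product of the first two, as a basic triple
    requires. *)
Definition gs_res a b c :=
  c - dot c a *: a - dot c (gs_b a b) *: gs_b a b - dot c (a *o gs_b a b) *: (a *o gs_b a b).
Definition gs_c a b c := normalize (gs_res a b c).
Definition gs_mx a b c := triple_mx a (gs_b a b) (gs_c a b c).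

Lemma imag_unit_normalize x : ocoord x 0 = 0 -> x != 0 -> imag_unit (normalize x).
Proof. by move=> x0 xn; split; [rewrite ocoordZ x0 mulr0|exact: dot_normalize]. Qed.

Lemma neq0_dot x : 0 < dot x x -> x != 0.
Proof. by apply: contraTneq => ->; rewrite dot0l ltxx. Qed.

Section Near.
Variables a b c : 'cV[R]_8.
Hypotheses (ia : imag_unit a) (ib : imag_unit b) (ic : imag_unit c).
Hypotheses (hab : `|dot a b| <= 4%:R^-1) (hac : `|dot a c| <= 4%:R^-1).
Hypotheses (hbc : `|dot b c| <= 4%:R^-1) (habc : `|dot (a *o b) c| <= 4%:R^-1).

Let ab2 : dot a b ^+ 2 <= 16%:R^-1.
Proof.
have -> : 16%:R^-1 = 4%:R^-1 ^+ 2 :> R by field.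
by rewrite -real_normK ?num_real // lerXn2r ?nnegrE ?invr_ge0 ?ler0n.
Qed.

Let res_b : dot (b - dot b a *: a) (b - dot b a *: a) = 1 - dot a b ^+ 2.
Proof.
have [[_ aa] [_ bb]] := (ia, ib).
by rewrite !(dotDl, dotDr) !(dotNl, dotNr) !(dotZl, dotZr) (dotC b a) aa bb; ring.
Qed.

Lemma gs_b_neq0 : b - dot b a *: a != 0.
Proof.
apply: neq0_dot; rewrite res_b subr_gt0; apply: le_lt_trans ab2 _.
by rewrite invf_lt1 ?ltr0n // ltr1n.
Qed.

Lemma gs_b_imag_unit : imag_unit (gs_b a b).
Proof.
apply: imag_unit_normalize gs_b_neq0; have [[a0 _] [b0 _]] := (ia, ib).
by rewrite ocoordD ocoordN ocoordZ a0 b0 mulr0 subrr.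
Qed.

Lemma dot_gs_b : dot a (gs_b a b) = 0.
Proof.
have [_ aa] := ia.
have e : dot a (b - dot b a *: a) = 0.
  by rewrite dotDr dotNr dotZr aa (dotC b a) mulr1 subrr.
by rewrite /gs_b /normalize dotZr e mulr0.
Qed.

(** By Pythagoras the squared norm is 1 minus three squared coefficients. Inner products of size at
    most 1/4 bound these by 1/16, 5/48 and 1/15, the last two after division by 1 - <a,b>^2 >=
    15/16. *)
Lemma gs_res_neq0 : gs_res a b c != 0.
Proof.
have [[a0 aa] [c0 cc]] := (ia, ic); have [b'0 bb'] := gs_b_imag_unit.
have ab' := dot_gs_b.
have [p0 pp] := imag_unit_mul ia gs_b_imag_unit ab'.
have [ap bp] := dot_mul_self ia gs_b_imag_unit.
apply: neq0_dot.
have -> : dot (gs_res a b c) (gs_res a b c) =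
    1 - (dot a c ^+ 2 + dot (gs_b a b) c ^+ 2 + dot (a *o gs_b a b) c ^+ 2).
  rewrite /gs_res.
  move: (gs_b a b) (a *o gs_b a b) bb' ab' pp ap bp => u p uu au pp ap bp.
  rewrite !(dotDl, dotDr) !(dotNl, dotNr) !(dotZl, dotZr) (dotC u a) (dotC p a) (dotC p u).
  by rewrite (dotC c a) (dotC c u) (dotC c p) aa cc uu au pp ap bp; ring.
set s := Num.sqrt (dot (b - dot b a *: a) (b - dot b a *: a)).
have s2 : s ^+ 2 = 1 - dot a b ^+ 2 by rewrite /s sqr_sqrtr ?dot_ge0 ?res_b.
have s0 : s ^+ 2 >= 15%:R / 16%:R.
  by rewrite s2 lerBrDr -lerBrDl; apply: le_trans ab2 _; lra.
have e1 : s ^+ 2 * dot (gs_b a b) c ^+ 2 = (dot b c - dot a b * dot a c) ^+ 2.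
  rewrite -exprMn /gs_b /normalize -/s dotZl dotDl dotNl dotZl (dotC b a) mulrA mulfV ?mul1r //.
  by apply: contraTneq s0 => ->; rewrite expr0n /= -ltNge; lra.
(* The Gram-Schmidt correction becomes a multiple of a a = -1, which is orthogonal to the imaginary
   [c]. *)
have e2 : s ^+ 2 * dot (a *o gs_b a b) c ^+ 2 = dot (a *o b) c ^+ 2.
  rewrite -exprMn /gs_b /normalize -/s omulZr dotZl omulDr omulNr omulZr imag_unit_sqr //.
  rewrite dotDl dotNl dotZl dotNl dot1 c0 !(oppr0, mulr0) addr0 mulrA mulfV ?mul1r //.
  by apply: contraTneq s0 => ->; rewrite expr0n /= -ltNge; lra.
move: hab hac hbc habc s0 e1 e2; rewrite !ler_norml.
move: (dot a b) (dot a c) (dot b c) (dot (a *o b) c) (s ^+ 2) => k l m n w.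
move: (dot (gs_b a b) c) (dot (a *o gs_b a b) c) => X Y.
move=> /andP[k1 k2] /andP[l1 l2] /andP[m1 m2] /andP[n1 n2] w0 eX eY.
have hl : l ^+ 2 <= 16%:R^-1 by nra.
have hn : n ^+ 2 <= 16%:R^-1 by nra.
have hkl : -16%:R^-1 <= k * l <= 16%:R^-1 by apply/andP; split; nra.
have hm : (m - k * l) ^+ 2 <= 25%:R / 256%:R.
  by move/andP: hkl => [kl1 kl2]; move: (k * l) kl1 kl2 => q q1 q2; nra.
have w1 : 0 <= w - 15%:R / 16%:R by rewrite subr_ge0.
have hX : 15%:R / 16%:R * X ^+ 2 <= 25%:R / 256%:R.
  by have := mulr_ge0 w1 (sqr_ge0 X); rewrite mulrBl eX; lra.
have hY : 15%:R / 16%:R * Y ^+ 2 <= 16%:R^-1.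
  by have := mulr_ge0 w1 (sqr_ge0 Y); rewrite mulrBl eY; lra.
by rewrite subr_gt0; lra.
Qed.

Lemma gs_triple : triple a (gs_b a b) (gs_c a b c).
Proof.
have [[a0 aa] [c0 cc]] := (ia, ic); have ib' := gs_b_imag_unit; have [b'0 bb'] := ib'.
have ab' := dot_gs_b.
have [p0 pp] := imag_unit_mul ia gs_b_imag_unit ab'.
have [ap bp] := dot_mul_self ia gs_b_imag_unit.
have rn := gs_res_neq0.
have r : [/\ ocoord (gs_res a b c) 0 = 0, dot a (gs_res a b c) = 0,
    dot (gs_b a b) (gs_res a b c) = 0 & dot (a *o gs_b a b) (gs_res a b c) = 0].
  move: bb' b'0 p0 ab' pp ap bp; rewrite /gs_res.
  move: (gs_b a b) (a *o gs_b a b) => u p uu u0 p0 au pp ap up.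
  rewrite !(ocoordD, dotDr) !(ocoordN, dotNr) !(ocoordZ, dotZr) a0 c0 u0 p0.
  rewrite (dotC u a) (dotC p a) (dotC p u) aa uu pp au ap up.
  by rewrite (dotC c a) (dotC c u) (dotC c p); split; ring.
have [r0 ra rb rp] := r.
by split=> //; [exact: imag_unit_normalize|split; rewrite dotZr ?ra ?rb ?rp mulr0].
Qed.

Lemma gs_mx_G2 : G2 R (gs_mx a b c).
Proof. exact: triple_mx_G2 gs_triple. Qed.

End Near.

Lemma gs_b_id a b : imag_unit b -> dot a b = 0 -> gs_b a b = b.
Proof. by move=> [_ bb] ab; rewrite /gs_b dotC ab scale0r subr0 normalize_id. Qed.

Lemma gs_c_id a b c : triple a b c -> gs_c a b c = c.
Proof.
move=> [ia ib [_ cc] ab [ac bc abc]].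
rewrite /gs_c /gs_res gs_b_id // (dotC c a) (dotC c b) (dotC c (a *o b)) ac bc abc.
by rewrite !scale0r !subr0 normalize_id.
Qed.

Lemma gs_mx_id a b c : triple a b c -> gs_mx a b c = triple_mx a b c.
Proof.
by move=> t; case: (t) => ia ib ic ab _; rewrite /gs_mx gs_c_id // gs_b_id.
Qed.

Lemma cts_triple_mx (T : topologicalType) (z0 : T) (f g h : T -> 'cV[R]_8) :
  {for z0, continuous f} -> {for z0, continuous g} -> {for z0, continuous h} ->
  {for z0, continuous (fun z => triple_mx (f z) (g z) (h z))}.
Proof.
move=> cf cg ch; have cfg := cts_omul cf cg.
apply: cts_mx => i j.
have -> : (fun z => triple_mx (f z) (g z) (h z) i j) = (fun z => [:: oct1 R; f z; g z;
    f z *o g z; h z; f z *o h z; g z *o h z; (f z *o g z) *o h z]`_j i 0).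
  by apply/funext => z; rewrite mxE.
apply: cts_entry; case: j => [] [|[|[|[|[|[|[|[|//]]]]]]]] _ /=.
- exact: cts_cst.
- exact: cf.
- exact: cg.
- exact: cfg.
- exact: ch.
- exact: (cts_omul cf ch).
- exact: (cts_omul cg ch).
- exact: (cts_omul cfg ch).
Qed.

Section Continuity.
Variables (T : topologicalType) (z0 : T) (f g h : T -> 'cV[R]_8).
Hypotheses (cf : {for z0, continuous f}) (cg : {for z0, continuous g})
  (ch : {for z0, continuous h}).

Lemma cts_gs_b : g z0 - dot (g z0) (f z0) *: f z0 != 0 ->
  {for z0, continuous (fun z => gs_b (f z) (g z))}.
Proof.
move=> n0; apply: (@cts_normalize R T z0 (fun z => g z - dot (g z) (f z) *: f z) n0).
exact: (ctsB cg (ctsZ (cts_dot cg cf) cf)).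
Qed.

Lemma cts_gs_mx : g z0 - dot (g z0) (f z0) *: f z0 != 0 ->
  gs_res (f z0) (g z0) (h z0) != 0 ->
  {for z0, continuous (fun z => gs_mx (f z) (g z) (h z))}.
Proof.
move=> n1 n2; have cb := cts_gs_b n1.
have cc : {for z0, continuous (fun z => gs_c (f z) (g z) (h z))}.
  apply: (@cts_normalize R T z0 (fun z => gs_res (f z) (g z) (h z)) n2); have cp := cts_omul cf cb.
  apply: ctsB; last exact: (ctsZ (cts_dot ch cp) cp).
  apply: ctsB; last exact: (ctsZ (cts_dot ch cb) cb).
  exact: (ctsB ch (ctsZ (cts_dot ch cf) cf)).
exact: (cts_triple_mx cf cb cc).
Qed.

End Continuity.
End GramSchmidt.

(** * The tower of stabilisers over S^6, S^5 and S^3 *)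

Section SimplyConnected.
Variable R : realType.
Implicit Types (x y : 'cV[R]_8) (g : 'M[R]_8).

(** The successive stabilisers are copies of SU(3), of SU(2) and of the trivial group. *)
Definition G2_e1 : set 'M[R]_8 := [set g | G2 R g /\ g *m e1 R = e1 R].
Definition G2_e12 : set 'M[R]_8 := [set g | G2_e1 g /\ g *m e2 R = e2 R].
Definition G2_e124 : set 'M[R]_8 := [set g | G2_e12 g /\ g *m e4 R = e4 R].

Lemma G2_e124E g : G2_e124 g -> g = 1%:M.
Proof.
by move=> [[[gG g1] g2] g4]; rewrite (G2_triple_mxE gG) g1 g2 g4 triple_mx_basis.
Qed.

Lemma cts_mulmxr (x : 'cV[R]_8) g :
  {for g, continuous (fun h : 'M[R]_8 => h *m x)}.
Proof. exact: (cts_mulmx (cts_id g) (cts_cst g x)). Qed.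

Arguments cts_mulmxr x g : clear implicits.

(** By [dot_le], moving a vector by less than 1/32 changes its inner product with a unit vector by
    at most 8/32, the tolerance 1/4 of Gram-Schmidt. *)
Let d : R := 32%:R^-1.
Let d0 : 0 < d. Proof. by rewrite invr_gt0. Qed.

Lemma dot_near x y u : dot u u = 1 -> dot x u = 0 -> `|x - y| < d ->
  `|dot y u| <= 4%:R^-1.
Proof.
move=> uu xu xy; have -> : dot y u = dot (y - x) u.
  by rewrite dotDl dotNl xu subr0.
have := @dot_le R (y - x) u d; rewrite distrC => /(_ (ltW xy) uu) h.
by apply: le_trans h _; rewrite /d; lra.
Qed.

Lemma norm0_le4 : `|0 : R| <= 4%:R^-1. Proof. by rewrite normr0. Qed.

Lemma sphere_imag_unit k x : (0 < k)%N -> sphere k x -> imag_unit x.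
Proof. by move=> k0 [xx xk]; split=> //; exact: xk. Qed.

Lemma e1_sphere : sphere 1 (e1 R).
Proof.
by split=> [|[]//]; rewrite ?dotE /e1 ?ocoord_oct //; ring.
Qed.

Lemma e2_sphere : sphere 2 (e2 R).
Proof.
by split=> [|[|[]]//]; rewrite ?dotE /e2 ?ocoord_oct //; ring.
Qed.

Lemma e4_sphere : sphere 4 (e4 R).
Proof.
by split=> [|[|[|[|[]]]]//]; rewrite ?dotE /e4 ?ocoord_oct //; ring.
Qed.

Lemma lift_e1 g y : G2 R g -> sphere 1 y -> `|g *m e1 R - y| < d ->
  let lift g y := gs_mx y (g *m e2 R) (g *m e4 R) in
  [/\ G2 R (lift g y), lift g y *m e1 R = y &
      {for (g, y), continuous (fun z => lift z.1 z.2)}].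
Proof.
move=> gG yS gy /=; have iy := sphere_imag_unit (ltn0Sn 0) yS.
have [ia ib ic ab [ac bc abc]] := G2_triple gG (triple_basis R).
have [[a0 aa] [b0 bb] [c0 cc]] := And3 ia ib ic.
have hb : `|dot y (g *m e2 R)| <= 4%:R^-1 by exact: dot_near bb ab gy.
have hc : `|dot y (g *m e4 R)| <= 4%:R^-1 by exact: dot_near cc ac gy.
have hbc : `|dot (g *m e2 R) (g *m e4 R)| <= 4%:R^-1 by rewrite bc norm0_le4.
(* Moving the factor to the other side gives the inner product of [y] with a unit vector orthogonal
   to the old first vector. *)
have habc : `|dot (y *o (g *m e2 R)) (g *m e4 R)| <= 4%:R^-1.
  rewrite dot_mulr; apply: dot_near gy; last by rewrite -dot_mulr.
  by rewrite dot_norm dot_oconj bb cc mulr1.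
split; first exact: gs_mx_G2.
  exact: triple_mx_e1.
have c2 (v : 'cV[R]_8) : {for (g, y), continuous (fun z : 'M[R]_8 * 'cV[R]_8 => z.1 *m v)}.
  apply: (@cts_comp _ (g, y) _ _ fst (fun h : 'M[R]_8 => h *m v)).
    exact: cts_fst.
  exact: (cts_mulmxr _ g).
apply: (cts_gs_mx (cts_snd _) (c2 _) (c2 _)).
  exact: gs_b_neq0.
exact: gs_res_neq0.
Qed.

Lemma lift_e2 g y : G2_e1 g -> sphere 2 y -> `|g *m e2 R - y| < d ->
  let lift g y := gs_mx (e1 R) y (g *m e4 R) in
  [/\ G2_e1 (lift g y), lift g y *m e2 R = y &
      {for (g, y), continuous (fun z => lift z.1 z.2)}].
Proof.
move=> [gG g1] yS gy /=; have iy := sphere_imag_unit (ltn0Sn 1) yS.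
have [ia ib ic ab [ac bc abc]] := G2_triple gG (triple_basis R).
rewrite g1 in ia ab ac abc.
have [[a0 aa] [b0 bb] [c0 cc]] := And3 ia ib ic.
have ey : dot (e1 R) y = 0.
  by have [_ y1] := yS; rewrite dotE /e1 !ocoord_oct (y1 0%N) // (y1 1%N) //; ring.
have hb : `|dot (e1 R) y| <= 4%:R^-1 by rewrite ey norm0_le4.
have hc : `|dot (e1 R) (g *m e4 R)| <= 4%:R^-1 by rewrite ac norm0_le4.
have hbc : `|dot y (g *m e4 R)| <= 4%:R^-1 by exact: dot_near cc bc gy.
have habc : `|dot (e1 R *o y) (g *m e4 R)| <= 4%:R^-1.
  rewrite dot_mull; apply: dot_near gy; last by rewrite -dot_mull.
  by rewrite dot_norm dot_oconj aa cc mulr1.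
split; first by split; [exact: gs_mx_G2|exact: triple_mx_e1].
  by rewrite [LHS]triple_mx_e2 gs_b_id.
have c2 : {for (g, y), continuous (fun z : 'M[R]_8 * 'cV[R]_8 => z.1 *m e4 R)}.
  apply: (@cts_comp _ (g, y) _ _ fst (fun h : 'M[R]_8 => h *m e4 R)).
    exact: cts_fst.
  exact: (cts_mulmxr _ g).
apply: (cts_gs_mx (cts_cst _ _) (cts_snd _) c2).
  exact: gs_b_neq0.
exact: gs_res_neq0.
Qed.

Lemma triple_e12 y : sphere 4 y -> triple (e1 R) (e2 R) y.
Proof.
move=> yS; have iy := sphere_imag_unit (ltn0Sn 3) yS; have [_ yk] := yS.
have [ia ib _ ab _] := triple_basis R; split=> //.
rewrite !dotE /e1 /e2 omul_oct !ocoord_oct (yk 0%N) // (yk 1%N) // (yk 2%N) // (yk 3%N) //.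
by split; ring.
Qed.

(** The stabiliser of e_1 and e_2 acts simply transitively on this S^3, so the point alone
    determines its lift. *)
Lemma lift_e4 g y : G2_e12 g -> sphere 4 y -> `|g *m e4 R - y| < d ->
  let lift g y := gs_mx (e1 R) (e2 R) y in
  [/\ G2_e12 (lift g y), lift g y *m e4 R = y &
      {for (g, y), continuous (fun z => lift z.1 z.2)}].
Proof.
move=> _ yS _ /=; have t := triple_e12 yS; have [ia ib ic ab [ac bc abc]] := t.
rewrite gs_mx_id //; split.
- split; last exact: triple_mx_e2.
  by split; [exact: triple_mx_G2|exact: triple_mx_e1].
- exact: triple_mx_e4.
apply: (cts_gs_mx (cts_cst _ _) (cts_cst _ _) (cts_snd _)).
  by apply: gs_b_neq0 => //; rewrite ab norm0_le4.
by apply: gs_res_neq0; rewrite ?ab ?ac ?bc ?abc ?norm0_le4.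
Qed.

Lemma lift_e1_id g : G2 R g -> gs_mx (g *m e1 R) (g *m e2 R) (g *m e4 R) = g.
Proof.
by move=> gG; rewrite gs_mx_id -?G2_triple_mxE //; exact: G2_triple gG (triple_basis R).
Qed.

Lemma lift_e2_id g : G2_e1 g -> gs_mx (e1 R) (g *m e2 R) (g *m e4 R) = g.
Proof. by move=> [gG g1]; rewrite -[in LHS]g1 lift_e1_id. Qed.

Lemma lift_e4_id g : G2_e12 g -> gs_mx (e1 R) (e2 R) (g *m e4 R) = g.
Proof. by move=> [gG g2]; rewrite -[in LHS]g2 lift_e2_id. Qed.

Lemma G2_sphere_e1 g : G2 R g -> sphere 1 (g *m e1 R).
Proof.
move=> gG; have [[a0 aa] _ _ _ _] := G2_triple gG (triple_basis R).
by split=> // -[].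
Qed.

Lemma G2_e1_sphere g : G2_e1 g -> sphere 2 (g *m e2 R).
Proof.
move=> [gG g1]; have [_ [a0 aa] _ ab _] := G2_triple gG (triple_basis R).
split=> // -[|[|]] // _; rewrite g1 in ab; rewrite -ab dotE /e1 !ocoord_oct; ring.
Qed.

Lemma G2_e12_sphere g : G2_e12 g -> sphere 4 (g *m e4 R).
Proof.
move=> [[gG g1] g2]; have [_ _ [a0 aa] _ [ac bc abc]] := G2_triple gG (triple_basis R).
rewrite g1 in ac abc; rewrite g2 in bc abc.
split=> // -[|[|[|[|]]]] // _.
- by rewrite -ac dotE /e1 !ocoord_oct; ring.
- by rewrite -bc dotE /e2 !ocoord_oct; ring.
- by rewrite -abc /e1 /e2 omul_oct dotE !ocoord_oct; ring.
Qed.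

Lemma G2_e124_1 : G2_e124 1%:M.
Proof.
split; last exact: mul1mx.
by split; [split; [exact: G2_1|exact: mul1mx]|exact: mul1mx].
Qed.

Lemma G2_joined g : G2 R g -> joined (G2 R) g 1%:M.
Proof.
move: g; apply: (@joined_fibration R _ _ (G2 R) (sphere 1)
  (fun g => g *m e1 R) (fun g y => gs_mx y (g *m e2 R) (g *m e4 R))
  d d0 G2_sphere_e1 lift_e1 lift_e1_id (e1 R)).
  by move=> w wS; apply: sphere_joined wS e1_sphere.
apply: (@joined_fibration R _ _ G2_e1 (sphere 2)
  (fun g => g *m e2 R) (fun g y => gs_mx (e1 R) y (g *m e4 R))
  d d0 G2_e1_sphere lift_e2 lift_e2_id (e2 R)).
  by move=> w wS; apply: sphere_joined wS e2_sphere.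
apply: (@joined_fibration R _ _ G2_e12 (sphere 4)
  (fun g => g *m e4 R) (fun g y => gs_mx (e1 R) (e2 R) y)
  d d0 G2_e12_sphere lift_e4 lift_e4_id (e4 R)).
  by move=> w wS; apply: sphere_joined wS e4_sphere.
move=> g gE; rewrite (G2_e124E gE); exists (fun=> 1%:M); split=> // t.
  exact: cts_cst.
exact: G2_e124_1.
Qed.

Lemma G2_homot (f : R -> 'M[R]_8) :
  (forall t, {for t, continuous f}) -> (forall t, G2 R (f t)) ->
  f 0 = 1%:M -> f 1 = 1%:M -> homot (G2 R) f (fun=> 1%:M).
Proof.
have [[E1 E2] E4] := G2_e124_1; have [G1 _] := E1.
move: f; apply: (@homot_fibration R _ _ (G2 R) (sphere 1)
  (fun g => g *m e1 R) (fun g y => gs_mx y (g *m e2 R) (g *m e4 R))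
  d d0 (cts_mulmxr _) G2_sphere_e1 lift_e1 lift_e1_id (e1 R)) => //.
  by move=> h ch hS h0 h1; apply: homot_sphere.
apply: (@homot_fibration R _ _ G2_e1 (sphere 2)
  (fun g => g *m e2 R) (fun g y => gs_mx (e1 R) y (g *m e4 R))
  d d0 (cts_mulmxr _) G2_e1_sphere lift_e2 lift_e2_id (e2 R)) => //.
  by move=> h ch hS h0 h1; apply: homot_sphere.
apply: (@homot_fibration R _ _ G2_e12 (sphere 4)
  (fun g => g *m e4 R) (fun g y => gs_mx (e1 R) (e2 R) y)
  d d0 (cts_mulmxr _) G2_e12_sphere lift_e4 lift_e4_id (e4 R)) => //.
  by move=> h ch hS h0 h1; apply: homot_sphere.
move=> f cf fE f0 f1; exists (fun=> 1%:M); split=> [z|z|t _|s].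
- exact: cts_cst.
- exact: G2_e124_1.
- by rewrite (G2_e124E (fE t)).
- by rewrite f0 f1.
Qed.

End SimplyConnected.

(** * Transfer from the identity to arbitrary base points *)

Section GroupTopology.
Variable R : realType.

Lemma cts_within_clamp (T : topologicalType) (f : R -> T) :
  {within `[0, 1], continuous f} -> forall t, {for t, continuous (fun t => f (clamp t))}.
Proof.
move=> /subspace_continuousP cf t.
have hc : `[0, 1]%classic (clamp t) by rewrite /= in_itv /=; exact: clamp_itv.
have ct := cts_clamp (cts_id t).
move=> A /(cf _ hc) hA.
have {}hA : nbhs (clamp t) [set z | `[0, 1]%classic z -> A (f z)] by exact: hA.
have : \near t, `[0, 1]%classic (clamp t) -> A (f (clamp t)) by exact: (ct _ hA).
apply: filterS => z; apply.
by rewrite /= in_itv /=; exact: clamp_itv.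
Qed.

Lemma cts_mulmxl (T : topologicalType) (z : T) (f : T -> 'M[R]_8) (A : 'M[R]_8) :
  {for z, continuous f} -> {for z, continuous (fun z => A *m f z)}.
Proof. exact: (cts_mulmx (cts_cst z A)). Qed.

Lemma simply_connected_G2 : simply_connected R (G2 R).
Proof.
split.
  split=> [|x y gx gy]; first by exists 1%:M; exact: G2_1.
  (* Left translation by [y] reduces the claim to paths that end at the identity. *)
  have gyx : G2 R (invmx y *m x) by apply: G2_mulmx => //; exact: G2_inv.
  have uy := G2_unit gy.
  have [g [cg Eg g0 g1]] := G2_joined gyx.
  exists (fun t => y *m g t); split.
  - by apply: continuous_subspaceT => t; exact: cts_mulmxl.
  - by move=> s _; exact: G2_mulmx.
  - by rewrite g0 mulKVmx.
  - by rewrite g1 mulmx1.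
move=> f x [cf fG f0 f1].
have gx : G2 R x by rewrite -f0; apply: fG; rewrite lexx ler01.
have ux := G2_unit gx.
have [t|t|||K [cK EK Kf K01]] := @G2_homot R (fun t => invmx x *m f (clamp t)).
- by apply: cts_mulmxl; exact: cts_within_clamp.
- by apply: G2_mulmx; [exact: G2_inv|exact: fG (clamp_itv t)].
- by rewrite clamp0 f0 mulVmx.
- by rewrite clamp1 f1 mulVmx.
exists (fun z => x *m K z); split.
- by apply: continuous_subspaceT => z; exact: cts_mulmxl.
- by move=> s t _ _; exact: G2_mulmx.
- move=> s hs; have [-> ->] := Kf s hs.
  by rewrite clamp_id // mulKVmx // mulmx1.
- move=> t _; have [-> ->] := K01 t.
  by rewrite clamp0 clamp1 f0 f1 mulVmx // mulmx1.
Qed.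

Lemma connected_G2 : connected (G2 R).
Proof.
(* The group is a union of images of paths that all contain the identity. *)
have -> : G2 R = \bigcup_(A in [set B : set 'M[R]_8 | connected B /\ (B 1%:M /\ B `<=` G2 R)]) A.
  apply/seteqP; split=> [g gG|g [A [_ [_ AG]] /AG //]].
  have [f [cf Ef f0 f1]] := G2_joined gG.
  exists (f @` `[0, 1]%classic); last by exists 0; rewrite //= in_itv /= lexx ler01.
  split.
    apply: connected_continuous_connected; first exact: segment_connected.
    by apply: continuous_subspaceT => t; exact: cf.
  split; first by exists 1; rewrite //= in_itv /= lexx ler01.
  by move=> _ [t _ <-]; exact: Ef.
apply: bigcup_connected => [|A []//].
by exists 1%:M => A [_ []].
Qed.

End GroupTopology.

(** * The Lie algebra *)

Section MatrixExponential.
Variables (R : realType) (n : nat).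
Implicit Type X : 'M[R]_n.+1.

Definition expmx_coeff X (k : nat) : 'M[R]_n.+1 := k`!%:R^-1 *: X ^+ k.

(** The entrywise maximum is not submultiplicative; the factor accounts for the n+1 terms in each
    entry of a product. *)
Definition mx_bound X : R := n.+1%:R * `|X|.

Lemma mx_entry_norm m p (A : 'M[R]_(m, p)) i j : `|A i j| <= `|A|.
Proof.
rewrite [leRHS]mx_normrE; exact: (le_trans _ (le_bigmax _ _ (i, j))).
Qed.

Lemma mx_bound_ge0 X : 0 <= mx_bound X.
Proof. by rewrite mulr_ge0. Qed.

Lemma expr_mx_bound X k i j : `|(X ^+ k) i j| <= mx_bound X ^+ k.
Proof.
elim: k i j => [|k IH] i j.
  by rewrite !expr0 mxE; case: (_ == _); rewrite ?normr1 ?normr0.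
rewrite exprS -mulmxE mxE exprS; apply: le_trans (ler_norm_sum _ _ _) _.
apply: le_trans (_ : \sum_(l < n.+1) `|X| * mx_bound X ^+ k <= _).
  apply: ler_sum => l _; rewrite normrM.
  apply: ler_pM; [exact: normr_ge0|exact: normr_ge0|exact: mx_entry_norm|exact: IH].
by rewrite sumr_const card_ord -mulr_natl mulrA lexx.
Qed.

Lemma expmx_coeff_bound X k i j : `|expmx_coeff X k i j| <= exp_coeff (mx_bound X) k.
Proof.
rewrite mxE normrM exp_coeffE normfV normr_nat; apply: ler_wpM2l.
  by rewrite invr_ge0.
exact: expr_mx_bound.
Qed.

Lemma series_entry (u : nat -> 'M[R]_n.+1) N i j :
  series u N i j = series (fun k => u k i j) N.
Proof. by rewrite /series /= summxE. Qed.

(** [expmx] is a [limn], informative only for a convergent series; convergence follows entrywise by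
    comparison with the scalar exponential. *)
Lemma expmx_cvg X : series (expmx_coeff X) N @[N --> \oo] --> expmx X.
Proof.
have cs i j : cvgn (series (fun k => expmx_coeff X k i j)).
  apply: normed_cvg; apply: (series_le_cvg (v_ := exp_coeff (mx_bound X))).
  - by move=> k /=.
  - by move=> k; apply: exp_coeff_ge0; exact: mx_bound_ge0.
  - by move=> k; exact: expmx_coeff_bound.
  - exact: is_cvg_series_exp_coeff.
have h : series (expmx_coeff X) N @[N --> \oo] -->
    (\matrix_(i, j) limn (series (fun k => expmx_coeff X k i j)) : 'M[R]_n.+1).
  apply: cvg_mx => i j; rewrite mxE.
  have -> : (fun N => series (expmx_coeff X) N i j) = series (fun k => expmx_coeff X k i j).
    by apply/funext => N; exact: series_entry.
  exact: cs.
rewrite /expmx -/(expmx_coeff X).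
by apply: (cvgP _ h).
Qed.

Lemma expmx_coeffS X k : k.+1%:R *: expmx_coeff X k.+1 = X *m expmx_coeff X k.
Proof.
rewrite /expmx_coeff scalerA factS natrM invfM mulrA divff ?pnatr_eq0 // mul1r.
by rewrite exprS -mulmxE scalemxAr.
Qed.

(** The terms of degree k >= 2 carry |t|^k <= |t|^2, and what remains is dominated by the
    exponential series. *)
Lemma expmx_tangent X (t : R) i j : `|t| <= 1 ->
  `|expmx (t *: X) i j - (1%:M + t *: X) i j| <= `|t| ^+ 2 * expR (mx_bound X).
Proof.
move=> t1; set a := mx_bound X.
have a0 : 0 <= a by exact: mx_bound_ge0.
set b := (1%:M + t *: X) i j.
have cu := cvg_entry (i := i) (j := j) (@expmx_cvg (t *: X)).
have cn : `|series (expmx_coeff (t *: X)) N i j - b| @[N --> \oo] -->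
    `|expmx (t *: X) i j - b|.
  by apply: cvg_norm; apply: cvgB; [exact: cu|exact: cvg_cst].
rewrite -(cvg_lim (@Rhausdorff R) cn); apply: limr_le; first exact: (cvgP _ cn).
near=> N; have N2 : (2 <= N)%N by near: N; exists 2%N.
rewrite series_entry /series /= (@big_cat_nat _ _ _ 2) //= !big_nat_recl // big_geq //.
have -> : expmx_coeff (t *: X) 0 i j + (expmx_coeff (t *: X) 1 i j + 0) = b.
  by rewrite /b /expmx_coeff expr0 expr1 !fact0 invr1 !scale1r addr0 [RHS]mxE.
rewrite addrAC subrr add0r; apply: le_trans (ler_norm_sum _ _ _) _.
apply: le_trans (_ : \sum_(2 <= k < N) `|t| ^+ 2 * exp_coeff a k <= _).
  apply: ler_sum_nat => k /andP[k2 _].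
  have -> : expmx_coeff (t *: X) k i j = t ^+ k * expmx_coeff X k i j.
    by rewrite /expmx_coeff exprZn !mxE mulrCA.
  rewrite normrM normrX; apply: ler_pM => //; last exact: expmx_coeff_bound.
  by apply: ler_wiXn2l => //.
rewrite -mulr_sumr; apply: ler_wpM2l; first exact: exprn_ge0.
apply: le_trans (_ : series (exp_coeff a) N <= _).
  rewrite /series /= [leRHS](@big_cat_nat _ _ _ 2) //= lerDr.
  by apply: sumr_ge0 => k _; exact: exp_coeff_ge0.
rewrite /expR; apply: nondecreasing_cvgn_le; last exact: is_cvg_series_exp_coeff.
by apply: nondecreasing_series => k _ _; exact: exp_coeff_ge0.
Unshelve. all: by end_near. Qed.

End MatrixExponential.

(** * Cauchy products of partial sums *)

Section CauchyProduct.
Variable V : zmodType.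
Variable w : nat -> nat -> V.

Lemma cauchy_triangle N :
  \sum_(0 <= k < N) \sum_(0 <= i < k.+1) w i (k - i) =
  \sum_(0 <= i < N) \sum_(0 <= j < N - i) w i j.
Proof.
elim: N => [|N IH]; first by rewrite !big_geq.
rewrite big_nat_recr //= IH [RHS]big_nat_recr //= subSn // subnn big_nat1.
rewrite [in LHS](@big_nat_recr _ _ _ N) //= subnn addrA; congr (_ + _).
rewrite -big_split /=; apply: eq_big_nat => i /andP[_ iN].
by rewrite subSn ?(ltnW iN) // big_nat_recr.
Qed.

(** What separates the product of partial sums from the partial sum of the Cauchy product is the
    corner i + j >= N; this is used both for octonions and for their scalar majorant. *)
Lemma cauchy_square N :
  \sum_(0 <= i < N) \sum_(0 <= j < N) w i j -
  \sum_(0 <= k < N) \sum_(0 <= i < k.+1) w i (k - i) =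
  \sum_(0 <= i < N) \sum_(N - i <= j < N) w i j.
Proof.
rewrite cauchy_triangle -sumrB; apply: eq_big_nat => i /andP[_ iN].
by rewrite (@big_cat_nat _ _ _ (N - i)) ?leq_subr //= addrAC subrr add0r.
Qed.

End CauchyProduct.

Lemma exp_coeff_cauchy (R : realType) (a : R) k :
  \sum_(0 <= i < k.+1) exp_coeff a i * exp_coeff a (k - i)%N = exp_coeff (a + a) k.
Proof.
rewrite !exp_coeffE exprDn mulr_sumr big_mkord; apply: eq_bigr => i _.
have ik : (i <= k)%N by rewrite -ltnS.
rewrite -mulr_natr -(bin_fact ik) !natrM.
have f0 m : m`!%:R != 0 :> R by rewrite pnatr_eq0 -lt0n fact_gt0.
have b0 : 'C(k, i)%:R != 0 :> R by rewrite pnatr_eq0 -lt0n bin_gt0.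
by field; rewrite !f0 b0.
Qed.

(** * Exponentials of derivations and tangents to automorphisms *)

Section Derivations.
Variable R : realType.
Implicit Types (x y : 'cV[R]_8) (X : 'M[R]_8).

Definition derivation X := forall x y,
  X *m (x *o y) = (X *m x) *o y + x *o (X *m y).

Lemma derivation_one X : derivation X -> X *m oct1 R = 0.
Proof.
move=> dX; have := dX (oct1 R) (oct1 R); rewrite !omul1l omul1r => h.
by apply: (addrI (X *m oct1 R)); rewrite addr0 -h.
Qed.

(** Dividing by the factorials removes the binomial coefficients. The induction proves k+1 times the
    identity, splitting the weight as i + (k+1-i). *)
Lemma leibniz X k x y : derivation X -> expmx_coeff X k *m (x *o y) =
  \sum_(0 <= i < k.+1) (expmx_coeff X i *m x) *o (expmx_coeff X (k - i) *m y).
Proof.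
move=> dX; elim: k => [|k IH].
  by rewrite big_nat1 /expmx_coeff expr0 fact0 invr1 scale1r !mul1mx.
have k0 : k.+1%:R != 0 :> R by rewrite pnatr_eq0.
apply: (scalerI k0); rewrite scalemxAl expmx_coeffS -mulmxA IH.
pose u i := expmx_coeff X i *m x; pose v i := expmx_coeff X i *m y.
have uS i : X *m u i = i.+1%:R *: u i.+1.
  by rewrite /u mulmxA -expmx_coeffS scalemxAl.
have vS i : X *m v i = i.+1%:R *: v i.+1.
  by rewrite /v mulmxA -expmx_coeffS scalemxAl.
rewrite mulmx_sumr -/(u _).
transitivity (\sum_(0 <= i < k.+1) (i.+1%:R *: (u i.+1 *o v (k - i)%N)) +
              \sum_(0 <= i < k.+1) ((k.+1 - i)%N%:R *: (u i *o v (k.+1 - i)%N))).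
  rewrite -big_split /=; apply: eq_big_nat => i /andP[_ ik].
  by rewrite dX uS vS omulZl omulZr subSn.
(* Both sums are brought to a common range; each term added has coefficient 0. *)
transitivity (\sum_(0 <= i < k.+2) (i%:R *: (u i *o v (k.+1 - i)%N)) +
              \sum_(0 <= i < k.+2) ((k.+1 - i)%N%:R *: (u i *o v (k.+1 - i)%N))).
  congr (_ + _); first by rewrite [RHS]big_nat_recl // scale0r add0r.
  by rewrite [RHS]big_nat_recr //= subnn scale0r addr0.
rewrite -big_split scaler_sumr /=; apply: eq_big_nat => i /andP[_ ik].
by rewrite -scalerDl -natrD subnKC.
Qed.

(** An entry is at most the Euclidean norm, which is multiplicative; the squared norms of the
    factors are at most 8 a^2 and 8 b^2. *)
Lemma omul_entry_bound x y (a b : R) l : 0 <= a -> 0 <= b ->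
  (forall i, `|x i 0| <= a) -> (forall i, `|y i 0| <= b) ->
  `|(x *o y) l 0| <= 8%:R * (a * b).
Proof.
move=> a0 b0 xa yb.
have db (z : 'cV[R]_8) c : 0 <= c -> (forall i, `|z i 0| <= c) -> dot z z <= 8%:R * c ^+ 2.
  move=> c0 zc; apply: le_trans (_ : \sum_(i < 8) c ^+ 2 <= _).
    apply: ler_sum => i _; rewrite -expr2 -real_normK ?num_real //.
    by apply: lerXn2r; rewrite ?nnegrE.
  by rewrite sumr_const card_ord mulr_natl.
have : (x *o y) l 0 ^+ 2 <= (8%:R * (a * b)) ^+ 2.
  apply: le_trans (_ : dot (x *o y) (x *o y) <= _).
    rewrite /dot (bigD1 l) //= -expr2 lerDl.
    by apply: sumr_ge0 => i _; rewrite -expr2 sqr_ge0.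
  rewrite dot_norm.
  have -> : (8%:R * (a * b)) ^+ 2 = (8%:R * a ^+ 2) * (8%:R * b ^+ 2) by ring.
  by apply: ler_pM; rewrite ?dot_ge0 //; exact: db.
have c0 : 0 <= 8%:R * (a * b) by rewrite mulr_ge0 // mulr_ge0.
by rewrite -[X in X <= _]real_normK ?num_real // ler_pXn2r ?nnegrE.
Qed.

(** By the Leibniz rule the defect of the partial sums is the corner of a Cauchy square. The
    corresponding scalar corner dominates it and tends to a multiple of e^a e^a - e^(2a) = 0. *)
Lemma expmx_mult X : derivation X -> multiplicative (expmx X).
Proof.
move=> dX x y; apply/colP => l; set a := mx_bound X.
have a0 : 0 <= a by exact: mx_bound_ge0.
(* The outer 8 comes from [omul_entry_bound], each inner 8 from the eight terms of a matrix-vector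
   product. *)
pose C : R := 8%:R * ((8%:R * `|x|) * (8%:R * `|y|)).
pose S := series (expmx_coeff X).
have cS : S N @[N --> \oo] --> expmx X by exact: expmx_cvg.
have cSv v : S N *m v @[N --> \oo] --> expmx X *m v.
  by apply: cvg_mulmx => //; exact: cvg_cst.
have cu : `|((S N *m x) *o (S N *m y) - S N *m (x *o y)) l 0| @[N --> \oo] -->
    `|((expmx X *m x) *o (expmx X *m y) - expmx X *m (x *o y)) l 0|.
  apply: cvg_norm; apply: cvg_entry; apply: cvgB; last exact: cSv.
  by apply: cvg_omul; exact: cSv.
pose E b := series (exp_coeff b : R ^nat).
have cE b : E b N @[N --> \oo] --> expR b by exact: is_cvg_series_exp_coeff.
have cv : C * (E a N * E a N - E (a + a) N) @[N --> \oo] -->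
    C * (expR a * expR a - expR (a + a)).
  by apply: cvgM; [exact: cvg_cst|apply: cvgB; [exact: cvgM|exact: cE]].
have ub N : `|((S N *m x) *o (S N *m y) - S N *m (x *o y)) l 0| <=
    C * (E a N * E a N - E (a + a) N).
  pose w i j := (expmx_coeff X i *m x) *o (expmx_coeff X j *m y).
  have -> : (S N *m x) *o (S N *m y) - S N *m (x *o y) =
      \sum_(0 <= i < N) \sum_(N - i <= j < N) w i j.
    rewrite -cauchy_square /S /series /= !mulmx_suml; congr (_ - _).
      by rewrite omul_suml; apply: eq_bigr => i _; rewrite omul_sumr.
    by apply: eq_bigr => k _; rewrite leibniz.
  have -> : E a N * E a N - E (a + a) N =
      \sum_(0 <= i < N) \sum_(N - i <= j < N) exp_coeff a i * exp_coeff a j.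
    rewrite -(cauchy_square (fun i j => exp_coeff a i * exp_coeff a j)).
    rewrite /E /series /=; congr (_ - _).
      by rewrite mulr_suml; apply: eq_bigr => i _; rewrite mulr_sumr.
    by apply: eq_bigr => k _; rewrite exp_coeff_cauchy.
  rewrite summxE mulr_sumr; apply: le_trans (ler_norm_sum _ _ _) _.
  apply: ler_sum => i _; rewrite summxE mulr_sumr.
  apply: le_trans (ler_norm_sum _ _ _) _; apply: ler_sum => j _.
  have e0 k : 0 <= exp_coeff a k by exact: exp_coeff_ge0.
  have b v k r : `|(expmx_coeff X k *m v) r 0| <= 8%:R * (exp_coeff a k * `|v : 'cV[R]_8|).
    rewrite mxE; apply: le_trans (ler_norm_sum _ _ _) _.
    apply: le_trans (_ : \sum_(i < 8) exp_coeff a k * `|v| <= _); last first.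
      by rewrite sumr_const card_ord mulr_natl.
    apply: ler_sum => s _; rewrite normrM; apply: ler_pM => //.
      exact: expmx_coeff_bound.
    exact: mx_entry_norm.
  apply: le_trans (omul_entry_bound l _ _ (b x i) (b y j)) _.
  - by rewrite mulr_ge0 // mulr_ge0.
  - by rewrite mulr_ge0 // mulr_ge0.
  by rewrite /C le_eqVlt; apply/orP; left; apply/eqP; ring.
have : `|((expmx X *m x) *o (expmx X *m y) - expmx X *m (x *o y)) l 0| <= 0.
  rewrite expRD subrr mulr0 in cv.
  rewrite -(cvg_lim (@Rhausdorff R) cu) -[leRHS](cvg_lim (@Rhausdorff R) cv).
  by apply: ler_lim; [exact: (cvgP _ cu)|exact: (cvgP _ cv)|exact: nearW].
by rewrite normr_le0 !mxE subr_eq0 => /eqP ->.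
Qed.

Lemma expmx_one X : derivation X -> expmx X *m oct1 R = oct1 R.
Proof.
move=> dX; have cS : series (expmx_coeff X) N *m oct1 R @[N --> \oo] --> expmx X *m oct1 R.
  by apply: cvg_mulmx; [exact: expmx_cvg|exact: cvg_cst].
apply: (cvg_unique (@norm_hausdorff R 'cV[R]_8) cS).
apply: (cvg_trans _ (@cvg_cst _ (oct1 R) nat \oo _)).
apply: near_eq_cvg; near=> N.
have N1 : (1 <= N)%N by near: N; exists 1%N.
rewrite /series /= big_ltn // mulmxDl mulmx_suml big_nat_cond big1 ?addr0.
  by rewrite /expmx_coeff expr0 fact0 invr1 scale1r mul1mx.
move=> k /andP[/andP[k1 _] _]; case: k k1 => // k _.
by rewrite /expmx_coeff exprSr -mulmxE -scalemxAl -mulmxA derivation_one // mulmx0 scaler0.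
Unshelve. all: by end_near. Qed.

Lemma derivationZ X (t : R) : derivation X -> derivation (t *: X).
Proof. by move=> dX x y; rewrite -!scalemxAl dX omulZl omulZr scalerDr. Qed.

Lemma expmx_G2 X (t : R) : derivation X -> G2 R (expmx (t *: X)).
Proof.
move=> /derivationZ dX; apply/G2P.
by split; [exact: expmx_one (dX t)|exact: expmx_mult (dX t)].
Qed.

(** The difference quotients [D N] satisfy the exact rule D(xy) = (D x)(A y) + x (D y); in the limit
    [D N] tends to [X] and [A N] to the identity. *)
Lemma G2_derivation X : (forall t : R, G2 R (expmx (t *: X))) -> derivation X.
Proof.
move=> hX x y.
pose h (N : nat) : R := N.+1%:R^-1.
pose A N := expmx (h N *: X).
pose D N := N.+1%:R *: (A N - 1%:M).
have h0 : h N @[N --> \oo] --> (0 : R) by exact: cvg_harmonic.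
have hb N i j : `|(D N) i j - X i j| <= h N * expR (mx_bound X).
  have h1 : 0 < h N by rewrite invr_gt0.
  have hN : N.+1%:R * h N = 1 by rewrite divff.
  have e := @expmx_tangent _ _ X (h N) i j; rewrite (ger0_norm (ltW h1)) in e.
  have -> : D N i j - X i j = N.+1%:R * (A N i j - (1%:M + h N *: X) i j).
    by rewrite !mxE !mulrBr mulrDr mulrA hN mul1r opprD addrA.
  rewrite normrM (ger0_norm (ler0n _ _)).
  have -> : h N * expR (mx_bound X) = N.+1%:R * (h N ^+ 2 * expR (mx_bound X)).
    by rewrite expr2 !mulrA hN mul1r.
  apply: ler_wpM2l => //; apply: e.
  by rewrite invf_le1 // ler1n.
have cD : D N @[N --> \oo] --> X.
  apply: cvg_mx => i j; apply/subr_cvg0/norm_cvg0P.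
  apply: (@squeeze_cvgr _ _ _ _ (fun=> 0) (fun N => h N * expR (mx_bound X))).
  - by near=> N; rewrite normr_ge0 hb.
  - exact: cvg_cst.
  - by rewrite -[X in _ --> X](mul0r (expR (mx_bound X))); apply: cvgM => //; exact: cvg_cst.
have cA : A N @[N --> \oo] --> (1%:M : 'M[R]_8).
  have -> : A = fun N => 1%:M + h N *: D N.
    by apply/funext => N; rewrite /D scalerA mulVf // scale1r addrC subrK.
  rewrite -[X in _ --> X]addr0 -(scale0r X).
  by apply: cvgD; [exact: cvg_cst|exact: cvgZ].
have cDv (v : 'cV[R]_8) : D N *m v @[N --> \oo] --> X *m v by apply: cvg_mulmx => //; exact: cvg_cst.
have cAv (v : 'cV[R]_8) : A N *m v @[N --> \oo] --> (v : 'cV[R]_8).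
  by rewrite -[X in _ --> X]mul1mx; apply: cvg_mulmx => //; exact: cvg_cst.
apply: (cvg_unique (@norm_hausdorff R 'cV[R]_8) (cDv (x *o y))).
have -> : (fun N => D N *m (x *o y)) =
    (fun N => (D N *m x) *o (A N *m y) + x *o (D N *m y)).
  apply/funext => N; rewrite /D -!scalemxAl !mulmxBl !mul1mx (G2M _ _ (hX _)).
  rewrite omulZl omulZr -scalerDr; congr (_ *: _).
  by rewrite !(omulDl, omulDr) omulNl omulNr addrA subrK.
apply: cvgD; apply: cvg_omul; [exact: cDv|exact: cAv|exact: cvg_cst|exact: cDv].
Unshelve. all: by end_near. Qed.

Lemma lie_algebra_G2 : lie_algebra (G2 R) = [set X | derivation X].
Proof.
apply/seteqP; split=> X /=; first exact: G2_derivation.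
by move=> dX t; exact: expmx_G2.
Qed.

End Derivations.

(** * Associator identities and inner derivations *)

Section InnerDerivation.
Variable R : realType.
Implicit Types (a b x y z : 'cV[R]_8) (k : R).

Definition assoc x y z := (x *o y) *o z - x *o (y *o z).

Lemma assoc_altl x y z : assoc x y z = - assoc y x z.
Proof. by rewrite /assoc; oct_destruct x; oct_destruct y; oct_destruct z; oct_ring. Qed.

Lemma assoc_altr x y z : assoc x y z = - assoc x z y.
Proof. by rewrite /assoc; oct_destruct x; oct_destruct y; oct_destruct z; oct_ring. Qed.

Lemma assoc_moufang b x y : assoc (b *o x) x y = x *o assoc b x y.
Proof. by rewrite /assoc; oct_destruct x; oct_destruct y; oct_destruct b; oct_ring. Qed.

(** Polarisation of [assoc_moufang]: replace [x] by [x + a] and cancel the two diagonal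
    instances. *)
Lemma assoc_moufang_lin a b x y :
  assoc (b *o x) a y + assoc (b *o a) x y = x *o assoc b a y + a *o assoc b x y.
Proof.
have := assoc_moufang b (x + a) y.
have := assoc_moufang b x y; have := assoc_moufang b a y.
rewrite /assoc !(omulDl, omulDr, omulNl, omulNr) => /colP h1 /colP h2 /colP h3.
apply/colP => i; move: (h1 i) (h2 i) (h3 i) => {h1 h2 h3} h1 h2 h3.
by rewrite !mxlinE in h1 h2 h3 *; lra.
Qed.

(* The defect of [c, -] as a derivation is -3 [c, -, -]; the associator part of
   [der a b] compensates it by the Teichmueller identity. *)
Lemma der_mul a b x y : der a b (x *o y) = der a b x *o y + x *o der a b y.
Proof.
have h1 := assoc_altl x (a *o b - b *o a) y.
have h2 := assoc_altr x (a *o b - b *o a) y.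
have h3 := assoc_moufang_lin a b x y.
have h4 := assoc_altl a (b *o x) y.
have h5 := assoc_altl b a y.
have h6 : x *o assoc b a y = - (x *o assoc a b y) by rewrite h5 omulNr.
(* This identity holds in every nonassociative algebra by expansion alone. *)
have teich : assoc (a *o b) x y - assoc a (b *o x) y + assoc a b (x *o y) =
    a *o assoc b x y + assoc a b x *o y.
  by rewrite /assoc !(omulDl, omulDr, omulNl, omulNr); lin.
move: h1 h2 h3 h4 h6 teich; rewrite /der /assoc.
rewrite !(omulDl, omulDr, omulNl, omulNr, omulZl, omulZr).
move=> /colP h1 /colP h2 /colP h3 /colP h4 /colP h6 /colP h7; apply/colP => i.
move: (h1 i) (h2 i) (h3 i) (h4 i) (h6 i) (h7 i) => {h1 h2 h3 h4 h5 h6 h7}.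
by rewrite !mxlinE => h1 h2 h3 h4 h6 h7; lra.
Qed.

Lemma der_addr a b x y : der a b (x + y) = der a b x + der a b y.
Proof. by rewrite /der !(omulDl, omulDr); lin. Qed.

Lemma der_scaler a b k x : der a b (k *: x) = k *: der a b x.
Proof. by rewrite /der !(omulZl, omulZr); lin. Qed.

Lemma der_addm a b x y : der a (b + y) x = der a b x + der a y x.
Proof. by rewrite /der !(omulDl, omulDr, omulNl, omulNr); lin. Qed.

Lemma der_scalem a b k x : der a (k *: b) x = k *: der a b x.
Proof. by rewrite /der !(omulZl, omulZr, omulDl, omulDr, omulNl, omulNr); lin. Qed.

Lemma der_antisym a b x : der a b x = - der b a x.
Proof.
by rewrite /der; oct_destruct a; oct_destruct b; oct_destruct x; oct_ring.
Qed.

Lemma der_one_r a x : der a (oct1 R) x = 0.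
Proof. by rewrite /der omul1r !omul1l !subrr omul0l omul0r subrr scaler0 subr0. Qed.

Definition inner_der a b : 'M[R]_8 := \matrix_(i, j) der a b (delta_mx j 0) i 0.

Lemma inner_derE a b x : inner_der a b *m x = der a b x.
Proof.
have sx : x = \sum_j x j 0 *: delta_mx j 0.
  rewrite {1}(matrix_sum_delta x); apply: eq_bigr => k _.
  by rewrite big_ord_recl big_ord0 addr0.
have -> : der a b x = \sum_j x j 0 *: der a b (delta_mx j 0).
  rewrite {1}sx (big_morph (der a b) (der_addr a b) (_ : der a b 0 = 0)).
    by apply: eq_bigr => j _; exact: der_scaler.
  by have := der_scaler a b 0 0; rewrite !scale0r.
by apply/colP => i; rewrite mxE summxE; apply: eq_bigr => j _; rewrite !mxE mulrC.
Qed.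

Lemma mx_ext (A B : 'M[R]_8) : (forall x, A *m x = B *m x) -> A = B.
Proof.
move=> h; apply/matrixP => i j; have /colP/(_ i) := h (delta_mx j 0).
by rewrite -!colE !mxE.
Qed.

End InnerDerivation.

(** * Simplicity *)

Section SimpleLieAlgebra.
Variable R : realType.
Implicit Types (a b x y z p q r : 'cV[R]_8) (X Y : 'M[R]_8).

Lemma inner_der_derivation p q : derivation (inner_der p q).
Proof. by move=> x y; rewrite !inner_derE der_mul. Qed.

Lemma inner_der_bracket X p q : derivation X ->
  X *m inner_der p q - inner_der p q *m X = inner_der (X *m p) q + inner_der p (X *m q).
Proof.
move=> dX; apply: mx_ext => x; rewrite mulmxBl mulmxDl -!mulmxA !inner_derE /der.
rewrite !(mulmxBr, mulmxDr) -scalemxAr !(mulmxBr, mulmxDr) !dX.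
rewrite !mulmxBr !dX.
by rewrite !(omulDl, omulDr, omulNl, omulNr); lin.
Qed.

Lemma inner_der_addr p q r : inner_der p (q + r) = inner_der p q + inner_der p r.
Proof. by apply: mx_ext => x; rewrite mulmxDl !inner_derE der_addm. Qed.

Lemma inner_der_scaler p (k : R) q : inner_der p (k *: q) = k *: inner_der p q.
Proof. by apply: mx_ext => x; rewrite -scalemxAl !inner_derE der_scalem. Qed.

Lemma inner_der_antisym p q : inner_der p q = - inner_der q p.
Proof. by apply: mx_ext => x; rewrite mulNmx !inner_derE der_antisym. Qed.

Lemma inner_der0r p : inner_der p 0 = 0.
Proof. by have := inner_der_scaler p 0 0; rewrite !scale0r. Qed.

Lemma inner_der0l p : inner_der 0 p = 0.
Proof. by rewrite inner_der_antisym inner_der0r oppr0. Qed.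

Lemma inner_der_self p : inner_der p p = 0.
Proof.
have h := inner_der_antisym p p; apply/matrixP => i j; rewrite [RHS]mxE.
by move/matrixP/(_ i j): h => h; rewrite [RHS]mxE in h; lra.
Qed.

Lemma inner_der_one p : inner_der p (oct1 R) = 0.
Proof. by apply: mx_ext => x; rewrite inner_derE der_one_r mul0mx. Qed.

Lemma derivation_jordan X x :
  derivation X -> (X *m x) *o x + x *o (X *m x) = (2%:R * ocoord x 0) *: (X *m x).
Proof.
move=> dX; rewrite -dX osqr mulmxBr -!scalemxAr derivation_one // scaler0 subr0.
by [].
Qed.

Lemma omul_jordan x y :
  x *o y + y *o x = (2%:R * ocoord x 0) *: y + (2%:R * ocoord y 0) *: x
    - (2%:R * dot x y) *: oct1 R.
Proof. by oct_destruct x; oct_destruct y; oct_ring. Qed.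

(** Differentiating u^2 = - |u|^2 at an imaginary u gives u w + w u = 0 for w = X u, that is 2 Re(w)
    u = 2 <w,u> 1; pairing with u forces Re(w) = 0 unless u = 0. *)
Lemma derivation_imag X x : derivation X -> ocoord (X *m x) 0 = 0.
Proof.
move=> dX; pose u := x - ocoord x 0 *: oct1 R.
have u0 : ocoord u 0 = 0 by rewrite ocoordD ocoordN ocoordZ /oct1 !ocoord_oct mulr1 subrr.
have -> : X *m x = X *m u.
  by rewrite mulmxBr -scalemxAr derivation_one // scaler0 subr0.
move: u u0 => u u0; set w := X *m u.
have [u00|un] := eqVneq u 0; first by rewrite /w u00 mulmx0 ocoord0.
have e : (2%:R * ocoord w 0) *: u = (2%:R * dot w u) *: oct1 R.
  apply/eqP; rewrite -subr_eq0; apply/eqP.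
  have := derivation_jordan u dX; rewrite omul_jordan u0 mulr0 !scale0r addr0.
  by [].
have := congr1 (dot u) e; rewrite !dotZr (dotC u (oct1 R)) dot1 u0 mulr0 => /eqP.
rewrite !mulf_eq0 pnatr_eq0 /= => /orP[/eqP //|/eqP/dot_eq0 u00].
by rewrite u00 eqxx in un.
Qed.

(** The real part of the differentiated quadratic relation gives <X u, u> = 0, which is then
    polarised. *)
Lemma derivation_skew X x y : derivation X -> dot (X *m x) y = - dot x (X *m y).
Proof.
move=> dX.
have im u : dot (X *m u) u = 0.
  have := derivation_jordan u dX.
  rewrite omul_jordan (derivation_imag _ dX) mulr0 scale0r add0r.
  move/(congr1 (dot (oct1 R))); rewrite dotDr dotNr !dotZr !dot1.
  by rewrite (derivation_imag _ dX) /oct1 !ocoord_oct; lra.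
have := im (x + y); rewrite mulmxDr !(dotDl, dotDr) !im (dotC (X *m y)); lra.
Qed.

(** Cutting off the coordinate of 1 leaves a skew block of odd size 7, whose determinant equals its
    own negative; the row and column cut off are zero. *)
Lemma derivation_kernel X : derivation X ->
  exists2 k, k != 0 & ocoord k 0 = 0 /\ X *m k = 0.
Proof.
move=> dX; pose Z : 'M[R]_(1 + 7) := X.
pose A := drsubmx Z.
have sk i j : X i j = - X j i.
  have := derivation_skew (delta_mx j 0) (delta_mx i 0) dX.
  rewrite -!colE !dotmxE; move=> h.
  have e1 (u : 'cV[R]_8) k : (u^T *m delta_mx k (0 : 'I_1)) 0 0 = u k 0.
    by rewrite -colE !mxE.
  have e2 (u : 'cV[R]_8) k : ((delta_mx k (0 : 'I_1))^T *m u) 0 0 = u k 0.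
    by rewrite trmx_delta -rowE !mxE.
  by move: h; rewrite e1 e2 !mxE.
have AT : A^T = - A by apply/matrixP => i j; rewrite !mxE sk.
have detA : \det A = 0.
  have := det_tr A; rewrite AT -scaleN1r detZ.
  have -> : (-1) ^+ 7 = -1 :> R by rewrite -signr_odd expr1.
  by rewrite mulN1r; lra.
have [v v0 vA] := det0P (introT eqP detA).
have Av : A *m v^T = 0.
  by apply: trmx_inj; rewrite trmx_mul trmxK AT mulmxN vA oppr0 trmx0.
pose k : 'cV[R]_(1 + 7) := col_mx 0 v^T.
have k0 : k != 0.
  apply: contraNneq v0 => kz; have := congr1 (@dsubmx _ 1 7 1) kz.
  by rewrite col_mxKd linear0 => /(congr1 trmx); rewrite trmxK trmx0 => ->; rewrite eqxx.
exists (k : 'cV[R]_8) => //; split.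
  rewrite /ocoord (_ : inord 0 = lshift 7 (0 : 'I_1) :> 'I_8); last first.
    by apply/val_inj; rewrite /= inordK.
  by rewrite (col_mxEu (0 : 'cV[R]_1) v^T) mxE.
have e00 := derivation_one dX.
have oneE : oct1 R = (delta_mx ord0 0 : 'cV[R]_8).
  apply/colP => i; rewrite /oct1 oct_coord mxE eqxx andbT.
  by case: i => [] [|[|[|[|[|[|[|[|//]]]]]]]].
have c0 i : X i ord0 = 0.
  by have /colP/(_ i) := e00; rewrite oneE -colE !mxE.
have r0 i : X ord0 i = 0 by rewrite sk c0 oppr0.
suff : Z *m k = 0 by [].
rewrite -[Z]submxK mul_block_col mulmx0 add0r -/A Av !mulmx0 addr0.
have -> : ursubmx Z = 0.
  apply/matrixP => i j; rewrite !mxE -[RHS](r0 (rshift 1 j)).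
  by congr (X _ _); apply/val_inj; rewrite /= ord1.
by rewrite mul0mx col_mx0.
Qed.
End SimpleLieAlgebra.

(** * The action of one inner derivation of an orthonormal pair *)

Section InnerAction.
Variable R : realType.
Variables a b : 'cV[R]_8.
Hypotheses (ia : imag_unit a) (ib : imag_unit b) (ab : dot a b = 0).
Let T := pair_table ia ib ab.

Lemma der_pair_l : der a b a = 4%:R *: b.
Proof.
by rewrite /der !(omulDl, omulDr, omulNl, omulNr, T, omul1l, omul1r); lin.
Qed.

Lemma der_pair_r : der a b b = - 4%:R *: a.
Proof.
by rewrite /der !(omulDl, omulDr, omulNl, omulNr, T, omul1l, omul1r); lin.
Qed.

Lemma der_pair_mul : der a b (a *o b) = 0.
Proof.
rewrite /der !(omulDl, omulDr, omulNl, omulNr, T, omul1l, omul1r).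
by apply/colP => ?; rewrite !mxlinE mxE; ring.
Qed.

(** Doubling around [s] gives a(bs) = (ba)s = -(ab)s, so the commutator part contributes 4 (ab)s and
    the associator part -6 (ab)s. *)
Lemma der_pair_perp s : ocoord s 0 = 0 -> dot a s = 0 -> dot b s = 0 ->
  dot (a *o b) s = 0 -> der a b s = - 2%:R *: ((a *o b) *o s).
Proof.
move=> s0 as0 bs0 cs0; have [c0 cc] := imag_unit_mul ia ib ab.
have bas : dot (b *o a) s = 0 by rewrite T dotNl cs0 oppr0.
rewrite /der (doubling_l s0 as0 bs0 bas) T.
by rewrite !(omulDl, omulDr, omulNl, omulNr) (omul_anti c0 s0 cs0); lin.
Qed.

(** The derivation turns the plane of [a] and [b] with factor 4 and is -2 times left multiplication
    by [a *o b] on the complement of the quaternions, invertible there; among imaginary directions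
    only [a *o b] is missed. *)
Lemma der_pair_onto r : ocoord r 0 = 0 -> exists q (k : R), r = k *: (a *o b) + der a b q.
Proof.
move=> r0; have ic := imag_unit_mul ia ib ab; have [c0 cc] := ic.
have [[a0 aa] [b0 bb]] := (ia, ib).
have [ac bc] := dot_mul_self ia ib.
set c := a *o b in ic c0 cc ac bc *.
pose s := r - dot r a *: a - dot r b *: b - dot r c *: c.
have s0 : ocoord s 0 = 0 by rewrite !(ocoordD, ocoordN, ocoordZ) r0 a0 b0 c0; ring.
have as0 : dot a s = 0.
  by rewrite !(dotDr, dotNr, dotZr) aa ab ac (dotC a r); ring.
have bs0 : dot b s = 0.
  by rewrite !(dotDr, dotNr, dotZr) (dotC b a) ab bb bc (dotC b r); ring.
have cs0 : dot c s = 0.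
  by rewrite !(dotDr, dotNr, dotZr) (dotC c a) (dotC c b) ac bc cc (dotC c r); ring.
have ca : c *o a = b by rewrite /c T.
have cb : c *o b = - a by rewrite /c T.
have t0 : ocoord (c *o s) 0 = 0 by rewrite ocoord_mul oconj_imag // dotNl cs0 oppr0.
have at0 : dot a (c *o s) = 0.
  by rewrite dotC dot_mull oconj_imag // omulNl ca dotNr dotC bs0 oppr0.
have bt0 : dot b (c *o s) = 0.
  by rewrite dotC dot_mull oconj_imag // omulNl cb opprK dotC as0.
have ct0 : dot c (c *o s) = 0.
  by rewrite dotC dot_mull oconj_imag // omulNl imag_unit_sqr // opprK dotC dot1 s0.
(* The coefficients invert a -> 4b, b -> -4a and s -> -2 c s, the last by c (c s) = - s. *)
exists (- (dot r a / 4%:R) *: b + (dot r b / 4%:R) *: a + (2%:R^-1) *: (c *o s)), (dot r c).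
rewrite !der_addr !der_scaler der_pair_l der_pair_r der_pair_perp // -/c imag_unit_altl //.
by rewrite /s; apply/colP => i; rewrite !mxlinE; field.
Qed.

End InnerAction.

Section BasisProducts.
Variable R : realType.
Variables u0 u1 u2 u3 u4 u5 u6 u7 : R.

(** Multiplication by a basis vector is a signed permutation of coordinates; these rules keep the
    terms in [derivation_casimir] free of eight-term sums. *)
Lemma omul_e1l : oct 0 1 0 0 0 0 0 0 *o oct u0 u1 u2 u3 u4 u5 u6 u7 =
  oct (- u1) u0 (- u3) u2 (- u5) u4 u7 (- u6).
Proof. by oct_ring. Qed.
Lemma omul_e1r : oct u0 u1 u2 u3 u4 u5 u6 u7 *o oct 0 1 0 0 0 0 0 0 =
  oct (- u1) u0 u3 (- u2) u5 (- u4) (- u7) u6.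
Proof. by oct_ring. Qed.
Lemma omul_e2l : oct 0 0 1 0 0 0 0 0 *o oct u0 u1 u2 u3 u4 u5 u6 u7 =
  oct (- u2) u3 u0 (- u1) (- u6) (- u7) u4 u5.
Proof. by oct_ring. Qed.
Lemma omul_e2r : oct u0 u1 u2 u3 u4 u5 u6 u7 *o oct 0 0 1 0 0 0 0 0 =
  oct (- u2) (- u3) u0 u1 u6 u7 (- u4) (- u5).
Proof. by oct_ring. Qed.
Lemma omul_e3l : oct 0 0 0 1 0 0 0 0 *o oct u0 u1 u2 u3 u4 u5 u6 u7 =
  oct (- u3) (- u2) u1 u0 (- u7) u6 (- u5) u4.
Proof. by oct_ring. Qed.
Lemma omul_e3r : oct u0 u1 u2 u3 u4 u5 u6 u7 *o oct 0 0 0 1 0 0 0 0 =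
  oct (- u3) u2 (- u1) u0 u7 (- u6) u5 (- u4).
Proof. by oct_ring. Qed.
Lemma omul_e4l : oct 0 0 0 0 1 0 0 0 *o oct u0 u1 u2 u3 u4 u5 u6 u7 =
  oct (- u4) u5 u6 u7 u0 (- u1) (- u2) (- u3).
Proof. by oct_ring. Qed.
Lemma omul_e4r : oct u0 u1 u2 u3 u4 u5 u6 u7 *o oct 0 0 0 0 1 0 0 0 =
  oct (- u4) (- u5) (- u6) (- u7) u0 u1 u2 u3.
Proof. by oct_ring. Qed.
Lemma omul_e5l : oct 0 0 0 0 0 1 0 0 *o oct u0 u1 u2 u3 u4 u5 u6 u7 =
  oct (- u5) (- u4) u7 (- u6) u1 u0 u3 (- u2).
Proof. by oct_ring. Qed.
Lemma omul_e5r : oct u0 u1 u2 u3 u4 u5 u6 u7 *o oct 0 0 0 0 0 1 0 0 =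
  oct (- u5) u4 (- u7) u6 (- u1) u0 (- u3) u2.
Proof. by oct_ring. Qed.
Lemma omul_e6l : oct 0 0 0 0 0 0 1 0 *o oct u0 u1 u2 u3 u4 u5 u6 u7 =
  oct (- u6) (- u7) (- u4) u5 u2 (- u3) u0 u1.
Proof. by oct_ring. Qed.
Lemma omul_e6r : oct u0 u1 u2 u3 u4 u5 u6 u7 *o oct 0 0 0 0 0 0 1 0 =
  oct (- u6) u7 u4 (- u5) (- u2) u3 u0 (- u1).
Proof. by oct_ring. Qed.
Lemma omul_e7l : oct 0 0 0 0 0 0 0 1 *o oct u0 u1 u2 u3 u4 u5 u6 u7 =
  oct (- u7) u6 (- u5) (- u4) u3 u2 (- u1) u0.
Proof. by oct_ring. Qed.
Lemma omul_e7r : oct u0 u1 u2 u3 u4 u5 u6 u7 *o oct 0 0 0 0 0 0 0 1 =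
  oct (- u7) (- u6) u5 u4 (- u3) (- u2) u1 u0.
Proof. by oct_ring. Qed.

End BasisProducts.

Definition omul_basis :=
  (omul_e1l, omul_e1r, omul_e2l, omul_e2r, omul_e3l, omul_e3r, omul_e4l, omul_e4r,
   omul_e5l, omul_e5r, omul_e6l, omul_e6r, omul_e7l, omul_e7r).

Section IdealArgument.
Variable R : realType.
Implicit Types (a b p q r x : 'cV[R]_8) (X Y : 'M[R]_8).

(** The octonions e_1, e_2, e_4 generate the algebra, and the product rule propagates the agreement
    to the other basis vectors. *)
Lemma der_basis_eq X Y : derivation X -> derivation Y ->
  X *m e1 R = Y *m e1 R -> X *m e2 R = Y *m e2 R -> X *m e4 R = Y *m e4 R -> X = Y.
Proof.
move=> dX dY h1 h2 h4; apply: mx_ext => x.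
have -> : x = triple_mx (e1 R) (e2 R) (e4 R) *m x by rewrite triple_mx_basis mul1mx.
rewrite (octE x) triple_mx_oct /quat_span.
rewrite !(omulDl, omulZl) !(mulmxDr, =^~ scalemxAr).
have E Z : derivation Z -> [/\ Z *m (e1 R *o e2 R) = (Z *m e1 R) *o e2 R + e1 R *o (Z *m e2 R),
  Z *m (oct1 R *o e4 R) = Z *m e4 R &
  [/\ Z *m (e1 R *o e4 R) = (Z *m e1 R) *o e4 R + e1 R *o (Z *m e4 R),
   Z *m (e2 R *o e4 R) = (Z *m e2 R) *o e4 R + e2 R *o (Z *m e4 R) &
   Z *m (e1 R *o e2 R *o e4 R) = ((Z *m e1 R) *o e2 R + e1 R *o (Z *m e2 R)) *o e4 R
       + (e1 R *o e2 R) *o (Z *m e4 R)]].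
  by move=> dZ; split; [exact: dZ|by rewrite omul1l|split; rewrite ?dZ].
have [-> -> [-> -> ->]] := E X dX; have [-> -> [-> -> ->]] := E Y dY.
by rewrite h1 h2 h4 !derivation_one.
Qed.

Lemma derivationD X Y : derivation X -> derivation Y -> derivation (X + Y).
Proof.
by move=> dX dY x y; rewrite !mulmxDl dX dY omulDl omulDr; lin.
Qed.

Definition e3 : 'cV[R]_8 := oct 0 0 0 1 0 0 0 0.
Definition e5 : 'cV[R]_8 := oct 0 0 0 0 0 1 0 0.
Definition e6 : 'cV[R]_8 := oct 0 0 0 0 0 0 1 0.
Definition e7 : 'cV[R]_8 := oct 0 0 0 0 0 0 0 1.

(* The scalar 12 is the Casimir eigenvalue on the adjoint representation. *)
Lemma derivation_casimir X : derivation X ->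
  12%:R *: X = inner_der (e1 R) (X *m e1 R) + inner_der (e2 R) (X *m e2 R) + inner_der e3 (X *m e3)
    + inner_der (e4 R) (X *m e4 R) + inner_der e5 (X *m e5) + inner_der e6 (X *m e6) + inner_der e7 (X *m e7).
Proof.
move=> dX.
have sk x y := derivation_skew x y dX.
have x3 : X *m e3 = (X *m e1 R) *o e2 R + e1 R *o (X *m e2 R).
  by rewrite -dX; congr (_ *m _); rewrite /e3 /e1 /e2 omul_oct; congr oct; ring.
have x5 : X *m e5 = (X *m e1 R) *o e4 R + e1 R *o (X *m e4 R).
  by rewrite -dX; congr (_ *m _); rewrite /e5 /e1 /e4 omul_oct; congr oct; ring.
have x6 : X *m e6 = (X *m e2 R) *o e4 R + e2 R *o (X *m e4 R).
  by rewrite -dX; congr (_ *m _); rewrite /e6 /e2 /e4 omul_oct; congr oct; ring.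
have x7 : X *m e7 = (X *m e3) *o e4 R + e3 *o (X *m e4 R).
  by rewrite -dX; congr (_ *m _); rewrite /e7 /e3 /e4 omul_oct; congr oct; ring.
(* The images of the three generators have 24 coordinates. These three relations and the seven
   skewness relations below leave 14 free, the dimension of G_2, so they are the only linear input
   required. *)
have := (derivation_imag (e1 R) dX, derivation_imag (e2 R) dX, derivation_imag (e4 R) dX).
have := (sk (e1 R) (e1 R), sk (e2 R) (e2 R), sk (e4 R) (e4 R), sk (e2 R) (e1 R),
  sk (e4 R) (e1 R), sk (e4 R) (e2 R), sk (e4 R) e3).
have dI p q : derivation (inner_der p q) by exact: inner_der_derivation.
move=> h1 h2; apply: der_basis_eq; first exact: derivationZ.
  by do !apply: derivationD => //.
all: rewrite !mulmxDl -scalemxAl !inner_derE x7 x5 x6 x3; move: h1 h2; rewrite x3.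
all: move: (X *m e1 R) (X *m e2 R) (X *m e4 R) => u v w.
all: rewrite (octE u) (octE v) (octE w).
all: move: (ocoord u 0) (ocoord u 1) (ocoord u 2) (ocoord u 3)
  (ocoord u 4) (ocoord u 5) (ocoord u 6) (ocoord u 7).
all: move: (ocoord v 0) (ocoord v 1) (ocoord v 2) (ocoord v 3)
  (ocoord v 4) (ocoord v 5) (ocoord v 6) (ocoord v 7).
all: move: (ocoord w 0) (ocoord w 1) (ocoord w 2) (ocoord w 3)
  (ocoord w 4) (ocoord w 5) (ocoord w 6) (ocoord w 7).
all: clear; rewrite /e1 /e2 /e3 /e4 /e5 /e6 /e7.
all: move=> w0 w1 w2 w3 w4 w5 w6 w7 v0 v1 v2 v3 v4 v5 v6 v7 u0 u1 u2 u3 u4 u5 u6 u7.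
all: rewrite /der !dotE !(omul_basis, octD, octN, octZ, ocoord_oct).
all: move=> [[[[[[h1 h2] h3] h4] h5] h6] h7] [[h8 h9] h10].
all: congr oct; lra.
Qed.
End IdealArgument.

(** * A nonzero ideal contains every derivation *)

Section Ideal.
Variable R : realType.
Implicit Types (a b p q r x : 'cV[R]_8) (X Y : 'M[R]_8).
Variable h : set 'M[R]_8.
Hypothesis hI : is_lie_ideal [set X | derivation X] h.

Lemma ideal_add X Y : h X -> h Y -> h (X + Y).
Proof. by case: hI => -[_ hl] _ _ hX hY; rewrite -[X]scale1r; exact: hl. Qed.

Lemma ideal_scale (k : R) X : h X -> h (k *: X).
Proof. by case: hI => -[h0 hl] _ _ hX; rewrite -[_ *: _]addr0; exact: hl. Qed.

Lemma ideal0 : h 0. Proof. by case: hI => -[]. Qed.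

Lemma ideal_inner_der X p q : h X -> h (inner_der (X *m p) q + inner_der p (X *m q)).
Proof.
move=> hX; case: hI => _ hg hb; rewrite -inner_der_bracket; last exact: hg.
rewrite -opprB -scaleN1r; apply: ideal_scale.
by apply: (hb (inner_der p q) X) => //; exact: inner_der_derivation.
Qed.

(** The vectors satisfying [Q] form a subspace containing 1; the aim is to fill the whole
    algebra. *)
Let Q p := forall r, h (inner_der p r).

Let Q_add p q : Q p -> Q q -> Q (p + q).
Proof.
move=> Qp Qq r; rewrite inner_der_antisym inner_der_addr opprD -!(inner_der_antisym _ r).
exact: ideal_add.
Qed.

Let Q_scale (k : R) p : Q p -> Q (k *: p).
Proof.
by move=> Qp r; rewrite inner_der_antisym inner_der_scaler -scalerN -inner_der_antisym; exact: ideal_scale.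
Qed.

Let Q_one : Q (oct1 R).
Proof. by move=> r; rewrite inner_der_antisym inner_der_one oppr0; exact: ideal0. Qed.

(** D_{a,b} kills ab, so its bracket with D_{ab,q} is D_{ab, D_{a,b} q}; such images together with
    ab fill the imaginary part, while D_{ab,ab} and D_{ab,1} vanish. *)
Lemma ideal_pair a b : imag_unit a -> imag_unit b -> dot a b = 0 -> h (inner_der a b) ->
  forall r, h (inner_der (a *o b) r).
Proof.
move=> ia ib ab hab r.
have -> : r = ocoord r 0 *: oct1 R + (r - ocoord r 0 *: oct1 R) by rewrite addrC subrK.
rewrite inner_der_addr inner_der_scaler inner_der_one scaler0 add0r.
have [|q [k ->]] := der_pair_onto ia ib ab (r := r - ocoord r 0 *: oct1 R).
  by rewrite ocoordD ocoordN ocoordZ /oct1 !ocoord_oct mulr1 subrr.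
rewrite inner_der_addr inner_der_scaler inner_der_self scaler0 add0r.
have := ideal_inner_der (a *o b) q hab.
by rewrite !inner_derE der_pair_mul // inner_der0l add0r.
Qed.

Lemma ideal_all a b : imag_unit a -> imag_unit b -> dot a b = 0 -> h (inner_der a b) ->
  forall p r, h (inner_der p r).
Proof.
move=> ia ib ab hab; have ic := imag_unit_mul ia ib ab.
have T := pair_table ia ib ab.
have [ac bc] := dot_mul_self ia ib.
have Qc : Q (a *o b) by exact: ideal_pair.
set c := a *o b in ic T ac bc Qc.
have ca : dot c a = 0 by rewrite dotC.
have cb : dot c b = 0 by rewrite dotC.
have Qb : Q b.
  have := ideal_pair ic ia ca (Qc a); rewrite /c T; exact.
have Qa : Q a.
  have := ideal_pair ic ib cb (Qc b); rewrite /c T => Qa r.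
  by have := Q_scale (-1) Qa r; rewrite scaleN1r opprK.
have [c0 cc] := ic.
(* Since c (c s) = - s, every such [s] is, up to scale, [c] times a unit vector orthogonal to [c],
   and [ideal_pair] applies to that pair. *)
have Qs s : ocoord s 0 = 0 -> dot c s = 0 -> Q s.
  move=> s0 cs.
  have t0 : ocoord (c *o s) 0 = 0 by rewrite ocoord_mul oconj_imag // dotNl cs oppr0.
  have [ct|ct] := eqVneq (c *o s) 0.
    have -> : s = 0 by apply: oppr_inj; rewrite -(imag_unit_altl s ic) ct omul0r oppr0.
    by move=> r; rewrite inner_der0l; exact: ideal0.
  have it := imag_unit_normalize t0 ct.
  have ctd : dot c (normalize (c *o s)) = 0.
    have e : dot c (c *o s) = 0.
      by rewrite dotC dot_mull oconj_imag // omulNl imag_unit_sqr // opprK dotC dot1 s0.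
    by rewrite dotZr e mulr0.
  have := ideal_pair ic it ctd (Qc _).
  rewrite /normalize omulZr imag_unit_altl // => Qn.
  have -> : s = (- Num.sqrt (dot (c *o s) (c *o s))) *:
      ((Num.sqrt (dot (c *o s) (c *o s)))^-1 *: - s).
    rewrite scalerA mulNr mulfV ?scaleN1r ?opprK //.
    rewrite sqrtr_eq0 -ltNge lt0r dot_ge0 andbT.
    by apply: contraNN ct => /eqP/dot_eq0 ->.
  exact: Q_scale.
move=> p.
have -> : p = ocoord p 0 *: oct1 R + (dot p c *: c + (p - ocoord p 0 *: oct1 R - dot p c *: c)).
  by lin.
apply: Q_add; first exact: (Q_scale _ Q_one).
apply: Q_add; first exact: (Q_scale _ Qc).
apply: Qs.
  by rewrite !(ocoordD, ocoordN, ocoordZ) c0 /oct1 !ocoord_oct; ring.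
by rewrite !(dotDr, dotNr, dotZr) cc (dotC c (oct1 R)) dot1 c0 (dotC c p); ring.
Qed.

Lemma ideal_nonzero X : h X -> X != 0 -> h = [set Y | derivation Y].
Proof.
move=> hX X0; have [_ hg _] := hI; have dX : derivation X := hg _ hX.
have [k k0 [ki Xk]] := derivation_kernel dX.
have [v Xv] : exists v : 'cV[R]_8, X *m v != 0.
  apply: contrapT => hv; move/negP: X0; apply; apply/eqP/mx_ext => x.
  by rewrite mul0mx; apply/eqP/negPn/negP => hx; apply: hv; exists x.
have Xvi := derivation_imag v dX.
have kv : dot k (X *m v) = 0.
  by rewrite -[LHS]opprK -derivation_skew // Xk dot0l oppr0.
have hk : h (inner_der k (X *m v)).
  by have := ideal_inner_der k v hX; rewrite Xk inner_der0l add0r.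
have all_inner : forall p r, h (inner_der p r).
  apply: (@ideal_all (normalize k) (normalize (X *m v))); rewrite ?imag_unit_normalize //.
  - exact: imag_unit_normalize.
  - exact: imag_unit_normalize.
  - by rewrite dotZl dotZr kv !mulr0.
  - rewrite inner_der_scaler inner_der_antisym inner_der_scaler -scalerN -inner_der_antisym.
    by apply: ideal_scale; exact: ideal_scale.
apply/seteqP; split=> [Y /hg //|Y dY].
(* The Casimir identity writes [12%:R *: Y] as a sum of inner derivations. *)
have -> : Y = 12%:R^-1 *: (12%:R *: Y) by rewrite scalerA mulVf ?scale1r ?pnatr_eq0.
by apply: ideal_scale; rewrite derivation_casimir //; do !apply: ideal_add.
Qed.

End Ideal.

Section Simple.
Variable R : realType.

Lemma simple_G2 : simple_lie_algebra (lie_algebra (G2 R)).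
Proof.
rewrite lie_algebra_G2; split.
- split.
    split=> [x y|k X Y dX dY]; first by rewrite !mul0mx omul0l omul0r addr0.
    by apply: derivationD => //; exact: derivationZ.
  move=> X Y dX dY x y; rewrite /lie_bracket !mulmxBl -!mulmxA dY dX.
  rewrite !mulmxDr !dX !dY !(omulDl, omulDr, omulNl, omulNr); lin.
- have [ia ib _ ab _] := triple_basis R.
  have ic := imag_unit_mul ia ib ab.
  have [ac bc] := dot_mul_self ia ib.
  set c := e1 R *o e2 R in ic ac bc.
  have ca : dot c (e1 R) = 0 by rewrite dotC.
  have cb : dot c (e2 R) = 0 by rewrite dotC.
  (* The first derivation kills [c] and sends e_1 to 4 e_2, so the bracket is 4 D_{c, e_2}, whose
     value at [c] is 16 e_2. *)
  exists (inner_der (e1 R) (e2 R)), (inner_der c (e1 R)); split.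
  + exact: inner_der_derivation.
  + exact: inner_der_derivation.
  rewrite /lie_bracket inner_der_bracket; last exact: inner_der_derivation.
  rewrite !inner_derE der_pair_mul // der_pair_l // inner_der_scaler.
  apply/eqP => /(congr1 (fun A => A *m c)); rewrite mul0mx mulmxDl -scalemxAl !inner_derE.
  rewrite der_pair_l //.
  rewrite -[der 0 _ _]inner_derE inner_der0l mul0mx add0r => /(congr1 (dot (e2 R))).
  have [_ bb] := ib; rewrite !dotZr bb (dotC _ 0) dot0l mulr1 => /eqP.
  by rewrite mulf_eq0 pnatr_eq0.
- move=> h hI; have [[X hX X0]|hN] := pselect (exists2 X, h X & X != 0).
    by right; exact: (ideal_nonzero hI hX X0).
  left; apply/seteqP; split=> [X hX|_ ->]; last exact: (ideal0 hI).
  by apply/eqP/negPn/negP => X0; apply: hN; exists X.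
Qed.

End Simple.

Theorem theorem1p9p3 (R : realType) :
  [/\ simply_connected R (G2 R), compact (G2 R) & simple_lie_group (G2 R)].
Proof.
split; [exact: simply_connected_G2|exact: compact_G2|split].
- exact: linear_lie_group_G2.
- exact: connected_G2.
- exact: simple_G2.
Qed.
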